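(* Let $k$ be a field, let $G$ and $\mathcal{G}$ be groups, let $\pi : G \to \mathrm{Aut}_{\mathrm{Group}}(\mathcal{G})$ be a group homomorphism, and let $\theta \in \mathrm{Aut}_{\mathrm{Group}}(\mathcal{G})$. Suppose that the $(\theta)$-orbits of $\mathcal{G}$ are finite, that $\theta_{k[\mathcal{G}]}$ is diagonalizable, that $\pi(g)\circ\theta = \theta\circ\pi(g)$ for all $g \in G$, and that there is an isomorphism $U \to \mathbf{U}$ ($\lambda \mapsto \boldsymbol{\lambda}$) from the subgroup $U \subseteq k^\times$ generated by the eigenvalues of $\theta_{k[\mathcal{G}]}$ to a subgroup $\mathbf{U}$ of $G$ with $\mathbf{U} \subseteq \mathrm{Ker}(\pi) \cap \mathrm{Z}(G)$. Then the biproduct $k[\mathcal{G}] \times k[G]$ formed from these data is lower cosolvable.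
   Context: $(\theta)$ is the cyclic group generated by $\theta$; $\theta_{k[\mathcal{G}]}$ is the linear extension of $\theta$ to $k[\mathcal{G}]$; diagonalizable means the space is the sum of eigenspaces over $k$; $\mathrm{Z}(G)$ is the center of $G$. The biproduct: put $B = k[\mathcal{G}]$, $H = k[G]$. $B$, with its usual Hopf algebra structure, is a left $H$-module by $g\cdot b = \pi(g)(b)$ ($g \in G$, $b \in \mathcal{G}$) and a left $H$-comodule by $\rho(b) = b_{(-1)} \otimes b_{(0)} = \boldsymbol{\lambda} \otimes b$ for $b$ in the $\lambda$-eigenspace $B_{(\lambda)}$ of $\theta_{k[\mathcal{G}]}$; this makes $B$ a Hopf algebra in the Yetter–Drinfel'd category ${}_H^H\mathcal{YD}$. $B \times H$ is the Hopf algebra over $k$ on $B \otimes H$ (tensors written $b \times h$) with $(b \times h)(b' \times h') = b(h_{(1)}\cdot b') \times h_{(2)}h'$, identity $1 \times 1$, $\Delta(b \times h) = (b_{(1)} \times b_{(2)(-1)}h_{(1)}) \otimes (b_{(2)(0)} \times h_{(2)})$, $\epsilon(b \times h) = \epsilon(b)\epsilon(h)$. A Hopf subalgebra $K$ of a Hopf algebra $A$ with antipode $S$ is normal if $a_{(1)}xS(a_{(2)}) \in K$ and $S(a_{(1)})xa_{(2)} \in K$ for all $a \in A$, $x \in K$. $K^+ = K \cap \mathrm{Ker}(\epsilon)$. A lower normal series for $A$ is a finite chain of Hopf subalgebras $k = A_n \subseteq A_{n-1} \subseteq \cdots \subseteq A_0 = A$ with $A_{i+1}$ normal in $A_i$ for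 all $i$; its factors are the quotient Hopf algebras $A_i/A_{i+1}^+A_i$. $A$ is lower cosolvable if it has a lower normal series all of whose factors are cocommutative. *)

(* Defs.v *)
From HB Require Import structures.
From mathcomp Require Import all_boot all_order all_algebra.
From mathcomp Require Import boolp classical_sets functions cardinality.
From mathcomp Require Import finmap generic_quotient.
From mathcomp.multinomials Require Import monalg.

Set Implicit Arguments.
Unset Strict Implicit.
Unset Printing Implicit Defensive.

Import GRing.Theory.
Local Open Scope classical_set_scope.
Local Open Scope quotient_scope.
Local Open Scope ring_scope.

Section LinearMaps.
Context (k : fieldType).
Implicit Types U V W : lmodType k.

Lemma lin0 U V (f : U -> V) : linear f -> f 0 = 0.
Proof. by move=> fl; have := fl (-1) 0 0; rewrite scaler0 addr0 scaleN1r addNr. Qed.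

Lemma linD U V (f : U -> V) : linear f -> {morph f : x y / x + y}.
Proof. by move=> fl x y; have := fl 1 x y; rewrite !scale1r. Qed.

Lemma linZ U V (f : U -> V) : linear f -> forall a, {morph f : x / a *: x}.
Proof. by move=> fl a x; have := fl a x 0; rewrite !(addr0, lin0 fl). Qed.

Lemma lin_sum U V (f : U -> V) I (s : seq I) F : linear f ->
  f (\sum_(i <- s) F i) = \sum_(i <- s) f (F i).
Proof. by move=> fl; apply: (big_morph f); [exact: linD | exact: lin0]. Qed.

Lemma sum_linear U V I (s : seq I) (F : I -> U -> V) :
  (forall i, linear (F i)) -> linear (fun x => \sum_(i <- s) F i x).
Proof.
move=> Fl a x y; rewrite scaler_sumr -big_split.
by apply: eq_bigr => i _; rewrite Fl.
Qed.

Lemma linear_comp U V W (f : V -> W) (g : U -> V) :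
  linear f -> linear g -> linear (fun x => f (g x)).
Proof. by move=> fl gl a x y; rewrite gl fl. Qed.

Lemma linear_id U : linear (fun x : U => x).
Proof. by []. Qed.

Lemma linear_Z U V (f : U -> V) a : linear f -> linear (fun x => a *: f x).
Proof. by move=> fl b x y; rewrite fl scalerDr !scalerA mulrC. Qed.

Definition bilin U V W (f : U -> V -> W) :=
  (forall v, linear (f^~ v)) /\ (forall u, linear (f u)).

End LinearMaps.

Section Tensor.
Context (k : fieldType) (V W : lmodType k).

(* Two formal sums of pairs represent the same tensor when no bilinear map
   separates them. *)
Definition tens_rel (s t : seq (V * W)) : bool :=
  `[< forall (X : lmodType k) (f : V -> W -> X), bilin f ->
        \sum_(u <- s) f u.1 u.2 = \sum_(u <- t) f u.1 u.2 >].

Lemma tens_rel_equiv : equiv_class_of tens_rel.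
Proof.
split=> [s|s t|t s u].
- exact/asboolP.
- by apply/asboolP/asboolP => st X f fb; rewrite st.
- by move=> /asboolP st /asboolP tu; apply/asboolP => X f fb; rewrite st ?tu.
Qed.

Canonical tens_equiv := EquivRelPack tens_rel_equiv.

Definition tensor : Type := {eq_quot tens_equiv}.
HB.instance Definition _ := Choice.on tensor.
HB.instance Definition _ := EqQuotient.on tensor.

Implicit Types (t : tensor).

Definition tens_seq t : seq (V * W) := repr t.

Definition tens_class (s : seq (V * W)) : tensor := \pi_tensor s.

Lemma tens_classP s s' :
  (forall (X : lmodType k) (f : V -> W -> X), bilin f ->
     \sum_(u <- s) f u.1 u.2 = \sum_(u <- s') f u.1 u.2) <->
  tens_class s = tens_class s'.
Proof.
split=> [h|h].
- by apply/(@eqquotP _ _ tensor); apply/asboolP.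
- by apply/asboolP; apply/(@eqquotP _ _ tensor).
Qed.

Lemma tens_seqK t : tens_class (tens_seq t) = t.
Proof. exact: reprK. Qed.

Lemma tens_classE (X : lmodType k) (f : V -> W -> X) s : bilin f ->
  \sum_(u <- tens_seq (tens_class s)) f u.1 u.2 = \sum_(u <- s) f u.1 u.2.
Proof. by move: X f; apply/tens_classP; rewrite tens_seqK. Qed.

Lemma tensP t t' :
  (forall (X : lmodType k) (f : V -> W -> X), bilin f ->
     \sum_(u <- tens_seq t) f u.1 u.2 = \sum_(u <- tens_seq t') f u.1 u.2) ->
  t = t'.
Proof. by move/tens_classP; rewrite !tens_seqK. Qed.

Definition tens0 := tens_class [::].
Definition tensD t t' := tens_class (tens_seq t ++ tens_seq t').
Definition tensZ (a : k) t := tens_class [seq (a *: u.1, u.2) | u <- tens_seq t].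

Lemma tens0E (X : lmodType k) (f : V -> W -> X) : bilin f ->
  \sum_(u <- tens_seq tens0) f u.1 u.2 = 0.
Proof. by move=> fb; rewrite tens_classE // big_nil. Qed.

Lemma tensDE (X : lmodType k) (f : V -> W -> X) t t' : bilin f ->
  \sum_(u <- tens_seq (tensD t t')) f u.1 u.2 =
  \sum_(u <- tens_seq t) f u.1 u.2 + \sum_(u <- tens_seq t') f u.1 u.2.
Proof. by move=> fb; rewrite tens_classE // big_cat. Qed.

Lemma tensZE (X : lmodType k) (f : V -> W -> X) a t : bilin f ->
  \sum_(u <- tens_seq (tensZ a t)) f u.1 u.2 =
  a *: \sum_(u <- tens_seq t) f u.1 u.2.
Proof.
move=> fb; rewrite tens_classE // big_map scaler_sumr.
by apply: eq_bigr => u _ /=; rewrite (linZ (fb.1 _)).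
Qed.

Lemma tensA : associative tensD.
Proof. by move=> x y z; apply: tensP => X f fb; rewrite !tensDE // addrA. Qed.
Lemma tensC : commutative tensD.
Proof. by move=> x y; apply: tensP => X f fb; rewrite !tensDE // addrC. Qed.
Lemma tens0D : left_id tens0 tensD.
Proof. by move=> x; apply: tensP => X f fb; rewrite tensDE // tens0E // add0r. Qed.
Lemma tensND : left_inverse tens0 (tensZ (-1)) tensD.
Proof.
move=> x; apply: tensP => X f fb.
by rewrite tensDE // tensZE // tens0E // scaleN1r addNr.
Qed.

HB.instance Definition _ :=
  GRing.isZmodule.Build tensor tensA tensC tens0D tensND.

Lemma tensZA a b t : tensZ a (tensZ b t) = tensZ (a * b) t.
Proof. by apply: tensP => X f fb; rewrite !tensZE // scalerA. Qed.
Lemma tensZ1 : left_id 1 tensZ.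
Proof. by move=> t; apply: tensP => X f fb; rewrite tensZE // scale1r. Qed.
Lemma tensZDr : right_distributive tensZ +%R.
Proof.
by move=> a x y; apply: tensP => X f fb; rewrite !(tensZE, tensDE) // scalerDr.
Qed.
Lemma tensZDl t : {morph tensZ^~ t : a b / a + b}.
Proof.
by move=> a b; apply: tensP => X f fb; rewrite !(tensZE, tensDE) // scalerDl.
Qed.

HB.instance Definition _ := GRing.Zmodule_isLmodule.Build k tensor
  tensZA tensZ1 tensZDr tensZDl.

Definition tens (v : V) (w : W) : tensor := tens_class [:: (v, w)].

End Tensor.

(* A tensor t coerces to a formal sum representing it, so that
   \sum_(u <- t) f u.1 u.2 is the value at t of the linear map induced by the
   bilinear map f (Sweedler notation); see liftE. *)
Coercion tens_seq : tensor >-> seq.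

Notation "V ⊗ W" := (tensor V W) (at level 40, left associativity) : type_scope.
Notation "v ⊗ w" := (tens v w) (at level 40, left associativity) : ring_scope.

Section TensorTheory.
Context (k : fieldType).
Implicit Types U V W X : lmodType k.

Lemma lift1 V W X (f : V -> W -> X) v w : bilin f ->
  \sum_(u <- (v ⊗ w)) f u.1 u.2 = f v w.
Proof. by move=> fb; rewrite tens_classE // big_seq1. Qed.

Lemma lift_linear V W X (f : V -> W -> X) : bilin f ->
  linear (fun t : V ⊗ W => \sum_(u <- t) f u.1 u.2).
Proof.
by move=> fb a x y; rewrite [in LHS](tensDE (tensZ a x) y fb) tensZE.
Qed.

Lemma tens_bilin V W : bilin (@tens k V W).
Proof.
split=> [w a x y|v a x y]; apply: tensP => X f fb.
  by rewrite (lift_linear fb) !lift1 // fb.1.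
by rewrite (lift_linear fb) !lift1 // fb.2.
Qed.

Lemma tensE V W (t : V ⊗ W) : t = \sum_(u <- t) u.1 ⊗ u.2.
Proof.
apply: tensP => X f fb.
rewrite [RHS](lin_sum _ _ (lift_linear fb)).
by apply: eq_bigr => u _; rewrite lift1.
Qed.

Lemma liftE V W X (f : V -> W -> X) I (s : seq I) F G : bilin f ->
  \sum_(u <- (\sum_(i <- s) F i ⊗ G i : V ⊗ W)) f u.1 u.2 =
  \sum_(i <- s) f (F i) (G i).
Proof.
move=> fb; rewrite (lin_sum _ _ (lift_linear fb)).
by apply: eq_bigr => i _; rewrite lift1.
Qed.

Lemma tens_ext V W X (f g : V ⊗ W -> X) : linear f -> linear g ->
  (forall v w, f (v ⊗ w) = g (v ⊗ w)) -> f =1 g.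
Proof.
move=> fl gl fg t; rewrite [t]tensE !lin_sum //.
by apply: eq_bigr => u _.
Qed.

End TensorTheory.

HB.mixin Record isHopf (k : fieldType) A of GRing.Algebra k A := {
  comul : A -> (A ⊗ A)%type;
  counit : A -> k;
  antipode : A -> A;
  comul_linear : linear comul;
  counit_linear : scalar counit;
  antipode_linear : linear antipode;
  comulA : forall a,
    \sum_(u <- comul a) \sum_(v <- comul u.1) v.1 ⊗ (v.2 ⊗ u.2) =
    \sum_(u <- comul a) \sum_(v <- comul u.2) u.1 ⊗ (v.1 ⊗ v.2);
  counitl : forall a, \sum_(u <- comul a) counit u.1 *: u.2 = a;
  counitr : forall a, \sum_(u <- comul a) counit u.2 *: u.1 = a;
  comul1 : comul 1 = 1 ⊗ 1;
  comulM : forall a b, comul (a * b) =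
    \sum_(u <- comul a) \sum_(v <- comul b) (u.1 * v.1) ⊗ (u.2 * v.2);
  counit1 : counit 1 = 1;
  counitM : forall a b, counit (a * b) = counit a * counit b;
  antipodel : forall a, \sum_(u <- comul a) antipode u.1 * u.2 = counit a *: 1;
  antipoder : forall a, \sum_(u <- comul a) u.1 * antipode u.2 = counit a *: 1
}.

#[short(type="hopfAlgType")]
HB.structure Definition Hopf (k : fieldType) :=
  {A of GRing.Algebra k A & isHopf k A}.

Section HopfTheory.
Context (k : fieldType).
Implicit Types A Q : hopfAlgType k.

Definition cocommutative A :=
  forall a : A, comul a = \sum_(u <- comul a) u.2 ⊗ u.1.

Definition hopf_morphism A Q (f : {lrmorphism A -> Q}) :=
  [/\ forall a, comul (f a) = \sum_(u <- comul a) f u.1 ⊗ f u.2,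
      forall a, counit (f a) = counit a &
      forall a, f (antipode a) = antipode (f a)].

(* The image of K ⊗ K in A ⊗ A. *)
Definition tens_set A (K : set A) : set (A ⊗ A)%type :=
  [set t | exists2 s : seq (A * A),
     (forall u, u \in s -> K u.1 /\ K u.2) & t = \sum_(u <- s) u.1 ⊗ u.2].

Definition hopf_subalgebra A (K : set A) :=
  [/\ forall (a : k) x y, K x -> K y -> K (a *: x + y),
      K 1 /\ (forall x y, K x -> K y -> K (x * y)),
      forall x, K x -> tens_set K (comul x) &
      forall x, K x -> K (antipode x)].

(* Meant for Hopf subalgebras L and K of A with L contained in K: the coproduct
   and the antipode of K are then the restrictions of those of A. *)
Definition normal_in A (L K : set A) :=
  forall a x, K a -> L x ->
    L (\sum_(u <- comul a) u.1 * x * antipode u.2) /\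
    L (\sum_(u <- comul a) antipode u.1 * x * u.2).

(* L^+ K *)
Definition aug_ideal A (L K : set A) : set A :=
  [set z | exists2 s : seq (A * A),
     (forall u, u \in s -> [/\ L u.1, counit u.1 = 0 & K u.2]) &
     z = \sum_(u <- s) u.1 * u.2].

(* Q is (a model of) the quotient Hopf algebra K / L^+ K: iota identifies the
   Hopf algebra K' with the Hopf subalgebra K of A, and p is onto with kernel
   L^+ K. *)
Definition is_factor A (K L : set A) (Q : hopfAlgType k) :=
  exists (K' : hopfAlgType k) (iota : {lrmorphism K' -> A})
         (p : {lrmorphism K' -> Q}),
    [/\ hopf_morphism iota, injective iota, range iota = K,
        hopf_morphism p &
        range p = [set: Q] /\
        forall x, p x = 0 <-> aug_ideal L K (iota x)].

Definition lower_normal_series A (n : nat) (F : nat -> set A) :=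
  [/\ F 0%N = [set: A],
      F n = range (fun c : k => c *: 1),
      forall i, (i <= n)%N -> hopf_subalgebra (F i) &
      forall i, (i < n)%N -> F i.+1 `<=` F i /\ normal_in (F i.+1) (F i)].

Definition lower_cosolvable A :=
  exists (n : nat) (F : nat -> set A),
    lower_normal_series n F /\
    forall i, (i < n)%N ->
      exists Q : hopfAlgType k, is_factor (F i) (F i.+1) Q /\ cocommutative Q.

End HopfTheory.

Section GroupAlgebra.
Context (k : fieldType) (G : groupType).

(* The k-space with basis G; malg carries a ring structure only over
   monomial monoids, hence the alias. *)
Definition galg : Type := {malg k[G]}.
HB.instance Definition _ := GRing.Lmodule.copy galg {malg k[G]}.

Definition gelt (g : G) : galg := mkmalgU g 1.

(* The linear extension to k[G] of a map defined on G. *)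
Definition gext (V : lmodType k) (f : G -> V) (x : galg) : V :=
  \sum_(g <- msupp x) mcoeff g x *: f g.

Lemma gextw (V : lmodType k) (f : G -> V) x (d : {fset G}) : (msupp x `<=` d)%fset ->
  gext f x = \sum_(g <- d) mcoeff g x *: f g.
Proof.
move=> sd; rewrite /gext; apply: (big_fset_incl _ sd) => g _.
by move/mcoeff_outdom ->; rewrite scale0r.
Qed.

Lemma gext_linear (V : lmodType k) (f : G -> V) : linear (gext f).
Proof.
move=> a x y; set d := (msupp x `|` msupp y)%fset.
have sx : (msupp x `<=` d)%fset by apply: fsubsetUl.
have sy : (msupp y `<=` d)%fset by apply: fsubsetUr.
have sxy : (msupp (a *: x + y) `<=` d)%fset.
  apply: (fsubset_trans (msuppD_le _ _)); rewrite fsubUset sy andbT.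
  exact: fsubset_trans (msuppZ_le _ _) sx.
rewrite (gextw _ sx) (gextw _ sy) (gextw _ sxy) scaler_sumr -big_split.
by apply: eq_bigr => g _; rewrite /= mcoeffD mcoeffZ scalerDl scalerA.
Qed.

Lemma gext1 (V : lmodType k) (f : G -> V) g : gext f (gelt g) = f g.
Proof.
rewrite (@gextw _ _ _ [fset g]%fset); last exact: msuppU_le.
by rewrite big_seq_fset1 mcoeffUU scale1r.
Qed.

Lemma galgE (x : galg) : x = gext gelt x.
Proof.
rewrite {1}(monalgE (x : {malg k[G]})); apply: eq_bigr => g _.
apply/malgP => h; rewrite mcoeffU.
by rewrite mcoeffZ mcoeffU mulr_natr.
Qed.

Lemma galg_ext (V : lmodType k) (f h : galg -> V) : linear f -> linear h ->
  (forall g, f (gelt g) = h (gelt g)) -> f =1 h.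
Proof.
move=> fl hl fh x; rewrite [x]galgE !lin_sum //.
by apply: eq_bigr => g _; rewrite !linZ // fh.
Qed.

Lemma gext_sum_linear (U V : lmodType k) (f : G -> U -> V) x :
  (forall g, linear (f g)) -> linear (fun u => gext (f^~ u) x).
Proof.
move=> fl; apply: (@sum_linear _ _ _ _ _ (fun g u => mcoeff g x *: f g u)) => g.
exact: linear_Z.
Qed.

Definition gone := gelt 1%g.
Definition gmul (x y : galg) : galg :=
  gext (fun g => gext (fun h => gelt (g * h)%g) y) x.

Lemma gmul_linl y : linear (gmul^~ y).
Proof. exact: gext_linear. Qed.
Lemma gmul_linr x : linear (gmul x).
Proof. by apply: gext_sum_linear => g; apply: gext_linear. Qed.
Lemma gmulE g h : gmul (gelt g) (gelt h) = gelt (g * h)%g.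
Proof. by rewrite /gmul !gext1. Qed.

Lemma gmulA : associative gmul.
Proof.
move=> x y z; apply: (galg_ext (f := fun x => gmul x (gmul y z))
  (h := fun x => gmul (gmul x y) z)) x => [||g].
- exact: gmul_linl.
- by apply: linear_comp; apply: gmul_linl.
apply: (galg_ext (f := fun y => gmul (gelt g) (gmul y z))
  (h := fun y => gmul (gmul (gelt g) y) z)) y => [||h].
- by apply: linear_comp; [apply: gmul_linr|apply: gmul_linl].
- by apply: linear_comp; [apply: gmul_linl|apply: gmul_linr].
apply: (galg_ext (f := fun z => gmul (gelt g) (gmul (gelt h) z))
  (h := fun z => gmul (gmul (gelt g) (gelt h)) z)) z => [||i].
- by apply: linear_comp; apply: gmul_linr.
- exact: gmul_linr.
by rewrite !gmulE mulgA.
Qed.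

Lemma gmul1 : left_id gone gmul.
Proof.
apply: galg_ext; [exact: gmul_linr|exact: linear_id|].
by move=> g; rewrite gmulE mul1g.
Qed.
Lemma gmulr1 : right_id gone gmul.
Proof.
apply: galg_ext; [exact: gmul_linl|exact: linear_id|].
by move=> g; rewrite gmulE mulg1.
Qed.
Lemma gmulDl : left_distributive gmul +%R.
Proof. by move=> x y z; apply: (linD (gmul_linl z)). Qed.
Lemma gmulDr : right_distributive gmul +%R.
Proof. by move=> x y z; apply: (linD (gmul_linr x)). Qed.

Lemma gone_neq0 : gone != 0.
Proof. by rewrite monalgU_eq0 oner_neq0. Qed.

HB.instance Definition _ := GRing.Zmodule_isNzRing.Build galg
  gmulA gmul1 gmulr1 gmulDl gmulDr gone_neq0.

Lemma gscaleAl (a : k) (x y : galg) : a *: (x * y) = (a *: x) * y.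
Proof. exact: esym (linZ (gmul_linl y) a x). Qed.
Lemma gscaleAr (a : k) (x y : galg) : a *: (x * y) = x * (a *: y).
Proof. exact: esym (linZ (gmul_linr x) a y). Qed.

HB.instance Definition _ :=
  GRing.Lmodule_isLalgebra.Build k galg gscaleAl.
HB.instance Definition _ :=
  GRing.Lalgebra_isAlgebra.Build k galg gscaleAr.

Lemma geltM g h : gelt (g * h)%g = gelt g * gelt h.
Proof. by rewrite -[RHS]/(gmul _ _) gmulE. Qed.
Lemma gelt1 : gelt 1%g = 1.
Proof. by []. Qed.

End GroupAlgebra.

Arguments gelt {k G} g.

Section AlgLinear.
Context (k : fieldType) (A : algType k).

Lemma linear_mull (V : lmodType k) (f : V -> A) x :
  linear f -> linear (fun y => f y * x).
Proof. by move=> fl a u v; rewrite fl mulrDl scalerAl. Qed.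
Lemma linear_mulr (V : lmodType k) (f : V -> A) x :
  linear f -> linear (fun y => x * f y).
Proof. by move=> fl a u v; rewrite fl mulrDr scalerAr. Qed.
Lemma linear_tensl (U V W : lmodType k) (f : U -> V) (w : W) :
  linear f -> linear (fun y => f y ⊗ w).
Proof. by move=> fl a u v; rewrite fl (tens_bilin V W).1. Qed.
Lemma linear_tensr (U V W : lmodType k) (f : U -> W) (v : V) :
  linear f -> linear (fun y => v ⊗ f y).
Proof. by move=> fl a u w; rewrite fl (tens_bilin V W).2. Qed.
Lemma linear_lift (U V W X : lmodType k) (f : V -> W -> X)
  (t : U -> (V ⊗ W)%type) :
  bilin f -> linear t -> linear (fun y => \sum_(u <- t y) f u.1 u.2).
Proof. by move=> fb tl a x y; rewrite tl (lift_linear fb). Qed.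
Lemma scalar_linear (U V : lmodType k) (f : U -> k) (v : V) :
  scalar f -> linear (fun u => f u *: v).
Proof. by move=> fl a x y; rewrite fl scalerDl scalerA. Qed.

End AlgLinear.

Section Bilinear.
Context (k : fieldType).

Lemma bilin_sum (U V X : lmodType k) I (s : seq I) (F : I -> U -> V -> X) :
  (forall i, bilin (F i)) -> bilin (fun u v => \sum_(i <- s) F i u v).
Proof.
move=> Fb; split=> [v|u].
  by apply: (@sum_linear _ _ _ _ _ (fun i u => F i u v)) => i; apply: (Fb i).1.
by apply: (@sum_linear _ _ _ _ _ (fun i v => F i u v)) => i; apply: (Fb i).2.
Qed.

Lemma bilin_lift (U V V1 V2 X : lmodType k) (t : U -> (V1 ⊗ V2)%type)
    (F : V1 -> V2 -> V -> X) :
  linear t -> (forall v, bilin (fun x y => F x y v)) ->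
  (forall x y, linear (F x y)) ->
  bilin (fun u v => \sum_(x <- t u) F x.1 x.2 v).
Proof.
move=> tl Fb Fl; split=> [v|u]; first exact: (linear_lift (Fb v) tl).
by apply: (@sum_linear _ _ _ _ _ (fun x v => F x.1 x.2 v)) => x.
Qed.

Lemma bilin_liftr (U V V1 V2 X : lmodType k) (t : V -> (V1 ⊗ V2)%type)
    (F : V1 -> V2 -> U -> X) :
  linear t -> (forall v, bilin (fun x y => F x y v)) ->
  (forall x y, linear (F x y)) ->
  bilin (fun u v => \sum_(x <- t v) F x.1 x.2 u).
Proof.
move=> tl Fb Fl; split=> [v|u]; last exact: (linear_lift (Fb u) tl).
by apply: (@sum_linear _ _ _ _ _ (fun x u => F x.1 x.2 u)) => x.
Qed.

Lemma bilin_mul (A : algType k) (U V : lmodType k) (f : U -> A) (g : V -> A) :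
  linear f -> linear g -> bilin (fun x y => f x * g y).
Proof. by move=> fl gl; split=> x; [apply: linear_mull|apply: linear_mulr]. Qed.

Lemma bilin_tens (U V X Y : lmodType k) (f : U -> X) (g : V -> Y) :
  linear f -> linear g -> bilin (fun x y => f x ⊗ g y).
Proof. by move=> fl gl; split=> x; [apply: linear_tensl|apply: linear_tensr]. Qed.

Lemma bilin_swap (U V X : lmodType k) (f : U -> V -> X) :
  bilin f -> bilin (fun v u => f u v).
Proof. by move=> fb; split=> x; [apply: fb.2|apply: fb.1]. Qed.

Lemma bilin_scale (U V X : lmodType k) (f : U -> k) (g : V -> X) :
  scalar f -> linear g -> bilin (fun u v => f u *: g v).
Proof. by move=> fl gl; split=> x; [apply: scalar_linear|apply: linear_Z]. Qed.

Lemma bilin_comp (U V X Y : lmodType k) (f : U -> V -> X) (h : X -> Y) :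
  bilin f -> linear h -> bilin (fun u v => h (f u v)).
Proof.
move=> fb hl; split=> [v|u].
  exact: (linear_comp hl (fb.1 v)).
exact: (linear_comp hl (fb.2 u)).
Qed.

End Bilinear.

Section GroupHopf.
Context (k : fieldType) (G : groupType).
Local Notation kG := (galg k G).

Definition gcomul : kG -> (kG ⊗ kG)%type := gext (fun g => gelt g ⊗ gelt g).
Definition gcounit : kG -> k := @gext k G k^o (fun=> 1).
Definition gantipode : kG -> kG := gext (fun g => gelt g^-1%g).

Lemma gcomul_linear : linear gcomul. Proof. exact: gext_linear. Qed.
Lemma gcounit_linear : scalar gcounit.
Proof. exact: (@gext_linear k G k^o). Qed.
Lemma gantipode_linear : linear gantipode. Proof. exact: gext_linear. Qed.
Lemma gcomulE g : gcomul (gelt g) = gelt g ⊗ gelt g.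
Proof. exact: gext1. Qed.
Lemma gcounitE g : gcounit (gelt g) = 1. Proof. exact: (@gext1 k G k^o). Qed.
Lemma gantipodeE g : gantipode (gelt g) = gelt g^-1%g. Proof. exact: gext1. Qed.

Let lcm := gcomul_linear.
Let lcu := gcounit_linear.
Let lan := gantipode_linear.
Let lid := @linear_id k kG.

Lemma gcomulA (a : kG) :
  \sum_(u <- gcomul a) \sum_(v <- gcomul u.1) v.1 ⊗ (v.2 ⊗ u.2) =
  \sum_(u <- gcomul a) \sum_(v <- gcomul u.2) u.1 ⊗ (v.1 ⊗ v.2).
Proof.
have b1 (w : kG) : bilin (fun x y : kG => x ⊗ (y ⊗ w)).
  by apply: bilin_tens => //; apply: linear_tensl.
have b1' (w : kG) : bilin (fun x y : kG => w ⊗ (x ⊗ y)).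
  apply: (bilin_comp (h := fun t => w ⊗ t)); first exact: bilin_tens.
  exact: linear_tensr.
have b2 : bilin (fun x y : kG => \sum_(v <- gcomul x) v.1 ⊗ (v.2 ⊗ y)).
  apply: (bilin_lift (F := fun x y v => x ⊗ (y ⊗ v))) => // x y.
  by apply: linear_tensr; apply: linear_tensr.
have b3 : bilin (fun x y : kG => \sum_(v <- gcomul y) x ⊗ (v.1 ⊗ v.2)).
  apply: (bilin_liftr (F := fun x y v => v ⊗ (x ⊗ y))) => // x y.
  exact: linear_tensl.
move: a; apply: galg_ext => [||g]; [exact: linear_lift b2 lcm|exact: linear_lift b3 lcm|].
by rewrite gcomulE (lift1 _ _ b2) (lift1 _ _ b3) gcomulE (lift1 _ _ (b1 _)) (lift1 _ _ (b1' _)).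
Qed.

Lemma gcounitl (a : kG) : \sum_(u <- gcomul a) gcounit u.1 *: u.2 = a.
Proof.
have b : bilin (fun x y : kG => gcounit x *: y) by apply: bilin_scale.
move: a; apply: galg_ext => [||g]; [exact: linear_lift b lcm|exact: lid|].
by rewrite gcomulE (lift1 _ _ b) gcounitE scale1r.
Qed.

Lemma gcounitr (a : kG) : \sum_(u <- gcomul a) gcounit u.2 *: u.1 = a.
Proof.
have b : bilin (fun x y : kG => gcounit y *: x).
  by apply: bilin_swap; apply: bilin_scale.
move: a; apply: galg_ext => [||g]; [exact: linear_lift b lcm|exact: lid|].
by rewrite gcomulE (lift1 _ _ b) gcounitE scale1r.
Qed.

Lemma gcomulM (a b : kG) : gcomul (a * b) =
  \sum_(u <- gcomul a) \sum_(v <- gcomul b) (u.1 * v.1) ⊗ (u.2 * v.2).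
Proof.
have b1 (x y : kG) : bilin (fun z w => (x * z) ⊗ (y * w)).
  by apply: bilin_tens; apply: linear_mulr lid.
have b2 : bilin (fun x y : kG =>
    \sum_(v <- gcomul b) (x * v.1) ⊗ (y * v.2)).
  by apply: bilin_sum => v; apply: bilin_tens; apply: linear_mull.
move: a; apply: galg_ext => [||g].
- exact: (linear_comp lcm (linear_mull _ lid)).
- exact: linear_lift b2 lcm.
rewrite gcomulE (lift1 _ _ b2).
move: b {b2}; apply: galg_ext => [||h].
- exact: (linear_comp lcm (linear_mulr _ lid)).
- exact: linear_lift (b1 _ _) lcm.
by rewrite gcomulE (lift1 _ _ (b1 _ _)) -!geltM gcomulE.
Qed.

Lemma gcounitM (a b : kG) : gcounit (a * b) = gcounit a * gcounit b.
Proof.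
move: a; apply: (@galg_ext k G k^o) => [||g].
- exact: (@linear_comp _ _ _ k^o _ _ lcu (linear_mull _ lid)).
- by move=> c x y; rewrite lcu mulrDl scalerAl.
rewrite gcounitE mul1r; move: b; apply: (@galg_ext k G k^o) => [||h].
- exact: (@linear_comp _ _ _ k^o _ _ lcu (linear_mulr _ lid)).
- exact: lcu.
by rewrite -geltM !gcounitE.
Qed.

Lemma gantipodel (a : kG) :
  \sum_(u <- gcomul a) gantipode u.1 * u.2 = gcounit a *: 1.
Proof.
have b : bilin (fun x y : kG => gantipode x * y) by apply: bilin_mul.
move: a; apply: galg_ext => [||g]; [exact: linear_lift b lcm|exact: scalar_linear lcu|].
by rewrite gcomulE (lift1 _ _ b) gcounitE scale1r gantipodeE -geltM mulVg.
Qed.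

Lemma gantipoder (a : kG) :
  \sum_(u <- gcomul a) u.1 * gantipode u.2 = gcounit a *: 1.
Proof.
have b : bilin (fun x y : kG => x * gantipode y) by apply: bilin_mul.
move: a; apply: galg_ext => [||g]; [exact: linear_lift b lcm|exact: scalar_linear lcu|].
by rewrite gcomulE (lift1 _ _ b) gcounitE scale1r gantipodeE -geltM mulgV.
Qed.

HB.instance Definition _ := isHopf.Build k kG
  gcomul_linear gcounit_linear gantipode_linear gcomulA gcounitl gcounitr
  (gcomulE 1%g) gcomulM (gcounitE 1%g) gcounitM gantipodel gantipoder.

End GroupHopf.

Record groupAut (G : groupType) := GroupAut {
  aut_fun :> G -> G;
  aut_inv : G -> G;
  autM : {morph aut_fun : x y / (x * y)%g};
  autK : cancel aut_fun aut_inv;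
  autVK : cancel aut_inv aut_fun
}.

Section GroupAut.
Context (G : groupType).
Implicit Types f g h : groupAut G.

HB.instance Definition _ := gen_eqMixin (groupAut G).
HB.instance Definition _ := gen_choiceMixin (groupAut G).

Lemma aut_eq f g : f =1 g -> f = g.
Proof.
case: f g => [f fi fM fK fV] [g gi gM gK gV] /= /funext fg; subst g.
have fgi : fi = gi by apply/funext => x; apply: (can_inj fK); rewrite fV gV.
subst gi; congr GroupAut; exact: Prop_irrelevance.
Qed.

Definition aut_one := @GroupAut G id id (fun _ _ => erefl) (fun=> erefl) (fun=> erefl).

Lemma aut_compM f g : {morph f \o g : x y / (x * y)%g}.
Proof. by move=> x y; rewrite /= !autM. Qed.
Definition aut_comp f g : groupAut G :=
  GroupAut (aut_compM f g) (can_comp (autK f) (autK g))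
    (can_comp (autVK g) (autVK f)).

Lemma aut_invM f : {morph aut_inv f : x y / (x * y)%g}.
Proof. by move=> x y; apply: (can_inj (autK f)); rewrite autM !autVK. Qed.
Definition aut_inverse f : groupAut G :=
  GroupAut (aut_invM f) (autVK f) (autK f).

Lemma aut_compA : associative aut_comp.
Proof. by move=> f g h; apply: aut_eq. Qed.
Lemma aut_1comp : left_id aut_one aut_comp.
Proof. by move=> f; apply: aut_eq. Qed.
Lemma aut_comp1 : right_id aut_one aut_comp.
Proof. by move=> f; apply: aut_eq. Qed.
Lemma aut_compV : left_inverse aut_one aut_inverse aut_comp.
Proof. by move=> f; apply: aut_eq => x /=; rewrite autK. Qed.
Lemma aut_compVr : right_inverse aut_one aut_inverse aut_comp.
Proof. by move=> f; apply: aut_eq => x /=; rewrite autVK. Qed.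

HB.instance Definition _ := isGroup.Build (groupAut G)
  aut_compA aut_1comp aut_comp1 aut_compV aut_compVr.

Lemma aut_mulE f g x : (f * g)%g x = f (g x). Proof. by []. Qed.
Lemma aut_oneE x : (1%g : groupAut G) x = x. Proof. by []. Qed.
Lemma aut1 f : f 1%g = 1%g.
Proof.
have := autM f 1%g 1%g; rewrite mulg1 => /(congr1 (fun z => ((f 1)^-1 * z)%g)).
by rewrite /= mulKg mulVg.
Qed.
Lemma autV f x : f x^-1%g = ((f x)^-1)%g.
Proof. by apply: (can_inj (mulKg (f x))); rewrite -autM !mulgV aut1. Qed.

Definition group_orbit f (x : G) : set G :=
  [set y | exists n : nat, y = (f ^+ n)%g x \/ y = (f ^- n)%g x].

Definition group_center : set G := [set z : G | forall g : G, (z * g)%g = (g * z)%g].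

Definition is_subgroup (S : set G) :=
  [/\ S 1%g, forall x y, S x -> S y -> S (x * y)%g &
      forall x, S x -> S (x^-1)%g].

End GroupAut.

Arguments group_center : clear implicits.

Section GroupMap.
Context (k : fieldType).

Definition gmap (G : groupType) (f : groupAut G) : galg k G -> galg k G :=
  gext (fun g => gelt (f g)).

Context (G : groupType).
Implicit Types (f h : groupAut G) (x y : galg k G).

Lemma gmap_linear f : linear (gmap f). Proof. exact: gext_linear. Qed.
Lemma gmapE f g : gmap f (gelt g) = gelt (f g). Proof. exact: gext1. Qed.

Let lg := gmap_linear.
Let lid := @linear_id k (galg k G).

Lemma gmapM f x y : gmap f (x * y) = gmap f x * gmap f y.
Proof.
move: x; apply: galg_ext => [||g].
- exact: linear_comp (lg f) (linear_mull _ lid).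
- exact: linear_mull (lg f).
move: y; apply: galg_ext => [||h].
- exact: linear_comp (lg f) (linear_mulr _ lid).
- exact: linear_mulr (lg f).
by rewrite -geltM !gmapE autM geltM.
Qed.

Lemma gmap1 f : gmap f 1 = 1.
Proof. by rewrite -!gelt1 gmapE aut1. Qed.

Lemma gmap_mul f h x : gmap (f * h)%g x = gmap f (gmap h x).
Proof.
move: x; apply: galg_ext => [||g]; [exact: lg|exact: linear_comp (lg _) (lg _)|].
by rewrite !gmapE.
Qed.

Lemma gmap_id x : gmap 1%g x = x.
Proof.
by move: x; apply: galg_ext => [||g]; [exact: lg|exact: lid|rewrite gmapE].
Qed.

Lemma gmap_counit f x : counit (gmap f x) = counit x.
Proof.
move: x; apply: (@galg_ext k G k^o) => [||g].
- exact: (@linear_comp _ _ _ k^o _ _ (@counit_linear _ _) (lg f)).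
- exact: counit_linear.
by rewrite gmapE -[LHS]/(gcounit _) -[RHS]/(gcounit _) !gcounitE.
Qed.

Lemma gmap_antipode f x : gmap f (antipode x) = antipode (gmap f x).
Proof.
have la := @antipode_linear k (galg k G).
move: x; apply: galg_ext => [||g].
- exact: linear_comp (lg f) la.
- exact: linear_comp la (lg f).
rewrite gmapE -[antipode _]/(gantipode _) -[RHS]/(gantipode _) !gantipodeE.
by rewrite gmapE autV.
Qed.

Lemma gmap_comul f x :
  comul (gmap f x) = \sum_(u <- comul x) gmap f u.1 ⊗ gmap f u.2.
Proof.
have lc := @comul_linear k (galg k G).
have b := bilin_tens (lg f) (lg f).
move: x; apply: galg_ext => [||g].
- exact: linear_comp lc (lg f).
- exact: linear_lift b lc.
rewrite gmapE -[LHS]/(gcomul _) -[comul _]/(gcomul _) !gcomulE.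
by rewrite (lift1 _ _ b) !gmapE.
Qed.

End GroupMap.

Section Eigen.
Context (k : fieldType) (V : lmodType k) (T : V -> V).

Definition lin_eigenvalue lam := exists2 v, v != 0 & T v = lam *: v.

(* s lists eigenvectors of T, paired with their eigenvalues, whose sum is v. *)
Definition eigen_decomp (s : seq (k * V)) (v : V) :=
  (forall u, u \in s -> T u.2 = u.1 *: u.2) /\ v = \sum_(u <- s) u.2.

Definition lin_diagonalizable := forall v, exists s, eigen_decomp s v.

Hypothesis Tl : linear T.

Lemma eig_indep (L : seq k) (w : k -> V) : uniq L ->
  (forall lam, T (w lam) = lam *: w lam) ->
  \sum_(lam <- L) w lam = 0 -> forall lam, lam \in L -> w lam = 0.
Proof.
elim: L w => [//|mu L IH] w /= /andP[muL uL] Tw; rewrite big_cons => sw.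
have wL lam : lam \in L -> w lam = 0.
  move=> lamL; pose w' lam := (lam - mu) *: w lam.
  have : w' lam = 0.
    apply: IH => // [nu|]; first by rewrite /w' (linZ Tl) Tw !scalerA mulrC.
    have : T (w mu + \sum_(nu <- L) w nu) -
        mu *: (w mu + \sum_(nu <- L) w nu) = 0.
      by rewrite sw (lin0 Tl) scaler0 subr0.
    rewrite (linD Tl) (lin_sum _ _ Tl) Tw scalerDr.
    rewrite opprD addrACA subrr add0r scaler_sumr -sumrB.
    move=> e; rewrite -[RHS]e; apply: eq_bigr => nu _.
    by rewrite Tw /w' scalerBl.
  move/eqP; rewrite scaler_eq0 subr_eq0 => /orP[/eqP lm|/eqP//].
  by rewrite -lm lamL in muL.
move=> lam; rewrite inE => /orP[/eqP ->|/wL//].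
by move: sw; rewrite big_seq big1 ?addr0 // => nu /wL.
Qed.

Lemma big_group (X : zmodType) (s : seq (k * V)) (F : k * V -> X) :
  \sum_(u <- s) F u =
  \sum_(lam <- undup (map fst s)) \sum_(u <- s | u.1 == lam) F u.
Proof.
rewrite (exchange_big_dep predT) //=.
rewrite big_seq [RHS]big_seq; apply: eq_bigr => u us.
rewrite (eq_bigl (pred1 u.1)) => [|lam]; last by rewrite /= eq_sym.
rewrite -big_filter filter_pred1_uniq ?undup_uniq ?big_seq1 //.
by rewrite mem_undup map_f.
Qed.

Lemma eig_sum0 (X : lmodType k) (Phi : k -> V -> X) s :
  (forall lam, linear (Phi lam)) -> eigen_decomp s 0 ->
  \sum_(u <- s) Phi u.1 u.2 = 0.
Proof.
move=> Pl [Ts s0]; rewrite big_group big_seq big1 // => lam lamL.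
rewrite (eq_bigr (fun u => Phi lam u.2)) => [|u /eqP -> //].
rewrite -big_filter -(lin_sum _ _ (Pl lam)) big_filter.
pose w lam := \sum_(u <- s | u.1 == lam) u.2.
rewrite -[X in Phi _ X]/(w lam).
rewrite (@eig_indep (undup (map fst s)) w) ?(lin0 (Pl _)) ?undup_uniq //.
  move=> mu; rewrite /w -big_filter (lin_sum _ _ Tl) scaler_sumr.
  rewrite big_seq [RHS]big_seq; apply: eq_bigr => u.
  by rewrite mem_filter => /andP[/eqP <- us]; rewrite Ts.
by rewrite -big_group.
Qed.

Lemma eig_sum (X : lmodType k) (Phi : k -> V -> X) s s' v :
  (forall lam, linear (Phi lam)) -> eigen_decomp s v -> eigen_decomp s' v ->
  \sum_(u <- s) Phi u.1 u.2 = \sum_(u <- s') Phi u.1 u.2.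
Proof.
move=> Pl [Ts sv] [Ts' sv'].
have : \sum_(u <- s ++ [seq (u.1, - u.2) | u <- s']) Phi u.1 u.2 = 0.
  apply: eig_sum0 => //; split=> [u|].
    rewrite mem_cat => /orP[/Ts//|/mapP[u' /Ts' e ->]] /=.
    by rewrite -scaleN1r (linZ Tl) e !scalerA mulrC.
  by rewrite big_cat big_map /= sumrN -sv -sv' subrr.
rewrite big_cat big_map /=.
under [X in _ + X]eq_bigr do rewrite -scaleN1r (linZ (Pl _)) scaleN1r.
by rewrite sumrN => /eqP; rewrite subr_eq0 => /eqP.
Qed.

Lemma diag_neq0 v : lin_diagonalizable ->
  exists2 s, eigen_decomp s v & forall u, u \in s -> u.2 != 0.
Proof.
move=> /(_ v)[s [Ts sv]]; exists [seq u <- s | u.2 != 0]; last first.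
  by move=> u; rewrite mem_filter => /andP[].
split=> [u|]; first by rewrite mem_filter => /andP[_ /Ts].
rewrite sv big_filter [LHS](bigID (fun u : k * V => u.2 != 0)) /=.
by rewrite [X in _ + X]big1 ?addr0 // => u /negPn/eqP.
Qed.

End Eigen.

Definition mul_subgroup (k : fieldType) (S : set k) :=
  [/\ S `<=` [set x | x != 0], S 1,
      forall x y, S x -> S y -> S (x * y) & forall x, S x -> S x^-1].

Definition eigen_group (k : fieldType) (V : lmodType k) (T : V -> V) : set k :=
  smallest (@mul_subgroup k) [set lam | lin_eigenvalue T lam].

(* The isomorphism from the group of eigenvalues onto bd_U is the restriction
   of bd_bold to this group; the other values of bd_bold are irrelevant. *)
Record biproduct_datum (k : fieldType) (G GG : groupType) := BiproductDatum {
  bd_pi : {multiplicative G -> groupAut GG};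
  bd_theta : groupAut GG;
  bd_U : set G;
  bd_bold : k -> G;
  bd_diag : lin_diagonalizable (gmap (k := k) bd_theta);
  bd_comm : forall g, (bd_pi g * bd_theta = bd_theta * bd_pi g)%g;
  bd_subgroup : is_subgroup bd_U;
  bd_boldM : forall x y, eigen_group (gmap (k := k) bd_theta) x ->
    eigen_group (gmap (k := k) bd_theta) y ->
    bd_bold (x * y) = (bd_bold x * bd_bold y)%g;
  bd_bij : set_bij (eigen_group (gmap (k := k) bd_theta)) bd_U bd_bold;
  bd_ker : bd_U `<=` [set g | bd_pi g = 1%g] `&` group_center G
}.

(* D only serves to select the Hopf algebra structure put on B ⊗ H. *)
Definition biproduct (k : fieldType) (G GG : groupType)
  (D : biproduct_datum k G GG) : Type := (galg k GG ⊗ galg k G)%type.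

Section Biproduct.
Context (k : fieldType) (G GG : groupType) (D : biproduct_datum k G GG).
Local Notation B := (galg k GG).
Local Notation H := (galg k G).
Local Notation T := (B ⊗ H)%type.
Local Notation pi := (bd_pi D).
Local Notation theta := (bd_theta D).
Local Notation bold := (bd_bold D).
Local Notation U := (eigen_group (gmap (k := k) theta)).

Definition bact (h : H) (b : B) : B := gext (fun g => gmap (pi g) b) h.

(* The linear map sending each b in the lam-eigenspace of theta to
   bold lam ⊗ b (see coact_eig); the result does not depend on the chosen
   eigenvector decomposition of b (see coactE). *)
Definition coact (b : B) : (H ⊗ B)%type :=
  \sum_(u <- xget [::] [set s | eigen_decomp (gmap theta) s b])
    gelt (bold u.1) ⊗ u.2.

Definition bmul (x y : T) : T :=
  \sum_(p <- x) \sum_(q <- y) \sum_(h <- comul p.2)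
    (p.1 * bact h.1 q.1) ⊗ (h.2 * q.2).

Definition bcomul (x : T) : (T ⊗ T)%type :=
  \sum_(p <- x) \sum_(b <- comul p.1) \sum_(h <- comul p.2)
    \sum_(c <- coact b.2) (b.1 ⊗ (c.1 * h.1)) ⊗ (c.2 ⊗ h.2).

Definition bcounit (x : T) : k := \sum_(p <- x) counit p.1 * counit p.2.

(* S(b x h) = (1 x S(b_(-1) h)) (S(b_(0)) x 1) *)
Definition bantipode (x : T) : T :=
  \sum_(p <- x) \sum_(c <- coact p.1)
    bmul (1 ⊗ antipode (c.1 * p.2)) (antipode c.2 ⊗ 1).

Let lidB := @linear_id k B.
Let lidH := @linear_id k H.
Let thl : linear (gmap (k := k) theta) := @gmap_linear k GG theta.
Let lcB := @comul_linear k B.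
Let lcH := @comul_linear k H.

Lemma gelt_comul (K : groupType) (g : K) :
  comul (gelt g : galg k K) = gelt g ⊗ gelt g.
Proof. exact: gcomulE. Qed.
Lemma gelt_counit (K : groupType) (g : K) : counit (gelt g : galg k K) = 1.
Proof. exact: gcounitE. Qed.
Lemma gelt_antipode (K : groupType) (g : K) :
  antipode (gelt g : galg k K) = gelt g^-1%g.
Proof. exact: gantipodeE. Qed.

Lemma bact_bilin : bilin bact.
Proof.
split=> [b|h]; first exact: gext_linear.
by apply: gext_sum_linear => g; apply: gmap_linear.
Qed.

Lemma bactE g b : bact (gelt g) b = gmap (pi g) b.
Proof. exact: gext1. Qed.

Lemma coactE s b : eigen_decomp (gmap theta) s b ->
  coact b = \sum_(u <- s) gelt (bold u.1) ⊗ u.2.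
Proof.
move=> sb; apply: (eig_sum (Phi := fun lam b => gelt (bold lam) ⊗ b) thl _ _ sb).
  by move=> lam; apply: linear_tensr lidB.
rewrite -[eigen_decomp _ _ _]/([set s | eigen_decomp (gmap theta) s b] _).
by apply: xgetPex; exists s.
Qed.

Lemma coact_linear : linear coact.
Proof.
move=> a x y.
have [s sx] := bd_diag D x; have [s' sy] := bd_diag D y.
rewrite (coactE sx) (coactE sy).
rewrite (@coactE ([seq (u.1, a *: u.2) | u <- s] ++ s')).
  rewrite big_cat big_map scaler_sumr; congr (_ + _); apply: eq_bigr => u _.
  by rewrite (linZ ((tens_bilin _ _).2 _)).
split=> [u|]; last by rewrite big_cat big_map -scaler_sumr -sx.2 -sy.2.
rewrite mem_cat => /orP[/mapP[u' /sx.1 e ->] /=|/sy.1//].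
by rewrite (linZ thl) e !scalerA mulrC.
Qed.

Lemma coact_eig lam b : gmap theta b = lam *: b ->
  coact b = gelt (bold lam) ⊗ b.
Proof.
move=> tb; rewrite (@coactE [:: (lam, b)]) ?big_seq1 //.
by split=> [u|]; [rewrite inE => /eqP ->|rewrite big_seq1].
Qed.

Lemma U_subgroup : mul_subgroup U.
Proof.
have US S : mul_subgroup S -> [set lam | lin_eigenvalue (gmap (k := k) theta) lam]
  `<=` S -> U `<=` S by move=> hS sS x; apply.
have gt0 : U `<=` [set x | x != 0].
  apply: US => [|mu [v v0 tv]].
    split=> //=; first exact: oner_neq0.
      by move=> x y x0 y0; rewrite mulf_neq0.
    by move=> x x0; rewrite invr_eq0.
  apply: contra_neq v0 => mu0.
  rewrite -[v]gmap_id -(mulVg theta) gmap_mul tv mu0 scale0r.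
  exact: lin0 (gmap_linear _).
split=> //.
- by move=> S [[]].
- move=> x y Ux Uy S hS; have [[_ _ SM _] _] := hS.
  by apply: SM; [apply: Ux|apply: Uy].
- by move=> x Ux S hS; have [[_ _ _ SV] _] := hS; apply: SV; apply: Ux.
Qed.

Lemma U_eig lam b : b != 0 -> gmap theta b = lam *: b -> U lam.
Proof. by move=> b0 tb S [_]; apply; exists b. Qed.

Lemma boldM x y : U x -> U y -> bold (x * y) = (bold x * bold y)%g.
Proof. exact: bd_boldM. Qed.

Lemma bold1 : bold 1 = 1%g.
Proof.
have [_ U1 _ _] := U_subgroup; have := boldM U1 U1; rewrite mulr1.
move=> /(congr1 (fun z => ((bold 1)^-1 * z)%g)).
by rewrite /= mulKg mulVg.
Qed.

Lemma bold_U x : U x -> bd_U D (bold x).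
Proof. by have [h _ _] := bd_bij D; apply: h. Qed.

Lemma bold_pi x : U x -> pi (bold x) = 1%g.
Proof. by move/bold_U/(bd_ker (b := D)) => []. Qed.

Lemma bold_central x g : U x -> (bold x * g)%g = (g * bold x)%g.
Proof. by move/bold_U/(bd_ker (b := D)) => [_]; apply. Qed.

Lemma eigP b : exists2 s, eigen_decomp (gmap theta) s b &
  forall u, u \in s -> U u.1.
Proof.
have [s sb s0] := diag_neq0 b (bd_diag D); exists s => // u us.
exact: U_eig (s0 _ us) (sb.1 _ us).
Qed.

Lemma piM g h : pi (g * h)%g = (pi g * pi h)%g. Proof. exact: gmulfM. Qed.
Lemma pi1 : pi 1%g = 1%g.
Proof.
have := piM 1%g 1%g; rewrite mulg1 => /(congr1 (fun z => ((pi 1%g)^-1 * z)%g)).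
by rewrite /= mulKg mulVg.
Qed.
Lemma piE g h b : gmap (pi (g * h)%g) b = gmap (pi g) (gmap (pi h) b) :> B.
Proof. by rewrite piM gmap_mul. Qed.
Lemma pi_theta g b : gmap (pi g) (gmap theta b) = gmap theta (gmap (pi g) b) :> B.
Proof. by rewrite -!gmap_mul bd_comm. Qed.

Lemma T_ext1 (X : lmodType k) (f h : T -> X) : linear f -> linear h ->
  (forall b g, f (b ⊗ gelt g) = h (b ⊗ gelt g)) -> f =1 h.
Proof.
move=> fl hl fh; apply: tens_ext => // b; apply: galg_ext => //.
- exact: linear_comp fl (linear_tensr _ lidH).
- exact: linear_comp hl (linear_tensr _ lidH).
Qed.

Lemma T_ext (X : lmodType k) (f h : T -> X) : linear f -> linear h ->
  (forall a g, f (gelt a ⊗ gelt g) = h (gelt a ⊗ gelt g)) -> f =1 h.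
Proof.
move=> fl hl fh; apply: T_ext1 => // b g; move: b; apply: galg_ext => //.
- exact: linear_comp fl (linear_tensl _ lidB).
- exact: linear_comp hl (linear_tensl _ lidB).
Qed.

Let bm1 (q1 : B) (q2 : H) (p1 : B) :
  bilin (fun h1 h2 => (p1 * bact h1 q1) ⊗ (h2 * q2)).
Proof.
apply: bilin_tens; last exact: linear_mull lidH.
by apply: linear_mulr; apply: bact_bilin.1.
Qed.

Let bm2 y : bilin (fun p1 p2 => \sum_(q <- (y : T)) \sum_(h <- comul p2)
    (p1 * bact h.1 q.1) ⊗ (h.2 * q.2)).
Proof.
apply: (@bilin_sum _ _ _ _ _ _ (fun q p1 p2 => \sum_(h <- comul p2)
  (p1 * bact h.1 q.1) ⊗ (h.2 * q.2))) => q.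
apply: (bilin_liftr (F := fun h1 h2 p1 => (p1 * bact h1 q.1) ⊗ (h2 * q.2))) => //.
by move=> h1 h2; apply: linear_tensl; apply: linear_mull lidB.
Qed.

Let bm3 p1 p2 : bilin (fun q1 q2 => \sum_(h <- comul (p2 : H))
    ((p1 : B) * bact h.1 q1) ⊗ (h.2 * q2)).
Proof.
apply: (@bilin_sum _ _ _ _ _ _ (fun h q1 q2 => (p1 * bact h.1 q1) ⊗ (h.2 * q2))) => h.
apply: bilin_tens; last exact: linear_mulr lidH.
by apply: linear_mulr; apply: bact_bilin.2.
Qed.

Lemma bmul_bilin : bilin bmul.
Proof.
split=> [y|x]; first exact: lift_linear (bm2 y).
apply: (@sum_linear _ _ _ _ _ (fun p y => \sum_(q <- (y : T))
  \sum_(h <- comul p.2) (p.1 * bact h.1 q.1) ⊗ (h.2 * q.2))) => p.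
exact: lift_linear (bm3 _ _).
Qed.

Lemma bmul_tens b h b' h' : bmul (b ⊗ h) (b' ⊗ h') =
  \sum_(u <- comul h) (b * bact u.1 b') ⊗ (u.2 * h').
Proof. by rewrite /bmul (lift1 _ _ (bm2 _)) (lift1 _ _ (bm3 _ _)). Qed.

Lemma bmulE b g b' g' : bmul (b ⊗ gelt g) (b' ⊗ gelt g') =
  (b * gmap (pi g) b') ⊗ gelt (g * g')%g.
Proof. by rewrite bmul_tens gelt_comul (lift1 _ _ (bm1 _ _ _)) bactE -geltM. Qed.

Let lidT := @linear_id k T.
Let mlr := bmul_bilin.1.
Let mll := bmul_bilin.2.

Lemma bmulA : associative bmul.
Proof.
move=> x y z; move: x; apply: T_ext1 => [||b g].
- exact: mlr.
- exact: linear_comp (mlr _) (mlr _).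
move: y; apply: T_ext1 => [||b' g'].
- exact: linear_comp (mll _) (mlr _).
- exact: linear_comp (mlr _) (mll _).
move: z; apply: T_ext1 => [||b'' g''].
- exact: linear_comp (mll _) (mll _).
- exact: mll.
by rewrite !bmulE mulgA gmapM piE mulrA.
Qed.

Definition bone : T := 1 ⊗ 1.

Let boneE : bone = 1 ⊗ gelt 1%g. Proof. by []. Qed.

Lemma bmul1 : left_id bone bmul.
Proof.
apply: T_ext1 => [||b g]; [exact: mll|exact: lidT|].
by rewrite boneE bmulE mul1g mul1r pi1 gmap_id.
Qed.

Lemma bmulr1 : right_id bone bmul.
Proof.
apply: T_ext1 => [||b g]; [exact: mlr|exact: lidT|].
by rewrite boneE bmulE mulg1 gmap1 mulr1.
Qed.

Lemma bmulDl : left_distributive bmul +%R.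
Proof. by move=> x y z; apply: (linD (mlr z)). Qed.
Lemma bmulDr : right_distributive bmul +%R.
Proof. by move=> x y z; apply: (linD (mll x)). Qed.

Let bcu : @bilin k B H k^o (fun b h => counit b * counit h).
Proof.
apply: (@bilin_mul _ k^o _ _ (@counit k B) (@counit k H)); exact: counit_linear.
Qed.

Lemma bcounit_linear : scalar bcounit.
Proof. exact: (@lift_linear k B H k^o _ bcu). Qed.

Lemma bcounitE b h : bcounit (b ⊗ h) = counit b * counit h.
Proof. exact: (@lift1 k B H k^o _ b h bcu). Qed.

Lemma bone_neq0 : bone != 0.
Proof.
apply: contraTneq isT => /(congr1 bcounit).
rewrite bcounitE !counit1 mulr1 (@lin0 _ _ k^o _ bcounit_linear).
by move/eqP; rewrite oner_eq0.
Qed.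

Let bc1 (x : B) (h1 h2 : H) :
  bilin (fun c1 c2 => (x ⊗ (c1 * h1)) ⊗ (c2 ⊗ h2 : T)).
Proof.
apply: bilin_tens; last exact: linear_tensl lidB.
by apply: linear_tensr; apply: linear_mull lidH.
Qed.

Let bc2 (h1 h2 : H) : bilin (fun x y : B => \sum_(c <- coact y)
  (x ⊗ (c.1 * h1)) ⊗ (c.2 ⊗ h2)).
Proof.
apply: (bilin_liftr (F := fun c1 c2 x => (x ⊗ (c1 * h1)) ⊗ (c2 ⊗ h2))) => //.
- exact: coact_linear.
- by move=> c1 c2; apply: linear_tensl; apply: linear_tensl lidB.
Qed.

Let bc3 (x y : B) : bilin (fun h1 h2 : H => \sum_(c <- coact y)
  (x ⊗ (c.1 * h1)) ⊗ (c.2 ⊗ h2)).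
Proof.
apply: (@bilin_sum _ _ _ _ _ _ (fun c h1 h2 => (x ⊗ (c.1 * h1)) ⊗ (c.2 ⊗ h2))) => c.
apply: bilin_tens; last exact: linear_tensr lidH.
by apply: linear_tensr; apply: linear_mulr lidH.
Qed.

Let bc4 : bilin (fun (b : B) (h : H) => \sum_(u <- comul b)
  \sum_(v <- comul h) \sum_(c <- coact u.2)
    (u.1 ⊗ (c.1 * v.1)) ⊗ (c.2 ⊗ v.2)).
Proof.
apply: (bilin_lift (F := fun x y h => \sum_(v <- comul h)
  \sum_(c <- coact y) (x ⊗ (c.1 * v.1)) ⊗ (c.2 ⊗ v.2))) => //.
- move=> h; apply: (@bilin_sum _ _ _ _ _ _ (fun v x y => \sum_(c <- coact y)
    (x ⊗ (c.1 * v.1)) ⊗ (c.2 ⊗ v.2))) => v.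
  exact: bc2.
- by move=> x y; apply: linear_lift (bc3 x y) lcH.
Qed.

Lemma bcomul_linear : linear bcomul. Proof. exact: lift_linear bc4. Qed.

Lemma bcomul_tens b h : bcomul (b ⊗ h) =
  \sum_(u <- comul b) \sum_(v <- comul h) \sum_(c <- coact u.2)
    (u.1 ⊗ (c.1 * v.1)) ⊗ (c.2 ⊗ v.2).
Proof. by rewrite /bcomul (lift1 _ _ bc4). Qed.

Definition bcomul2 (g : G) (y : (B ⊗ B)%type) : (T ⊗ T)%type :=
  \sum_(u <- y) \sum_(c <- coact u.2)
    (u.1 ⊗ (c.1 * gelt g)) ⊗ (c.2 ⊗ gelt g).

Lemma bcomul2_linear g : linear (bcomul2 g).
Proof. exact: lift_linear (bc2 _ _). Qed.

Lemma bcomul2E g x lam y : gmap theta y = lam *: y ->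
  bcomul2 g (x ⊗ y) = (x ⊗ gelt (bold lam * g)%g) ⊗ (y ⊗ gelt g).
Proof.
move=> ty; rewrite /bcomul2 (lift1 _ _ (bc2 _ _)) (coact_eig ty).
by rewrite (lift1 _ _ (bc1 _ _ _)) -geltM.
Qed.

Lemma bcomulE b g : bcomul (b ⊗ gelt g) = bcomul2 g (comul b).
Proof.
rewrite bcomul_tens; apply: eq_bigr => u _.
by rewrite gelt_comul (lift1 _ _ (bc3 _ _)).
Qed.

Lemma bcomulEg s a g : eigen_decomp (gmap theta) s (gelt a) ->
  bcomul (gelt a ⊗ gelt g) =
  \sum_(u <- s) (gelt a ⊗ gelt (bold u.1 * g)%g) ⊗ (u.2 ⊗ gelt g).
Proof.
move=> [se sa]; rewrite bcomulE gelt_comul [X in _ ⊗ X]sa.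
rewrite (lin_sum _ _ ((tens_bilin _ _).2 _)) (lin_sum _ _ (bcomul2_linear _)).
rewrite big_seq [RHS]big_seq; apply: eq_bigr => u us.
by rewrite (bcomul2E _ _ (se _ us)).
Qed.

Lemma tens_sumr (V W X : lmodType k) (x : X) (t : (V ⊗ W)%type) :
  \sum_(v <- t) x ⊗ (v.1 ⊗ v.2) = x ⊗ t.
Proof. by rewrite {2}[t]tensE (lin_sum _ _ ((tens_bilin _ _).2 _)). Qed.

Definition theta2 (y : (B ⊗ B)%type) : (B ⊗ B)%type :=
  \sum_(u <- y) gmap theta u.1 ⊗ gmap theta u.2.

Let th2b : bilin (fun x y : B => gmap theta x ⊗ gmap theta y).
Proof. exact: bilin_tens thl thl. Qed.

Lemma theta2_linear : linear theta2. Proof. exact: lift_linear th2b. Qed.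

Lemma bcomulA x :
  \sum_(u <- bcomul x) \sum_(v <- bcomul u.1) v.1 ⊗ (v.2 ⊗ u.2) =
  \sum_(u <- bcomul x) \sum_(v <- bcomul u.2) u.1 ⊗ (v.1 ⊗ v.2).
Proof.
have b1 (w : T) : bilin (fun x y : T => x ⊗ (y ⊗ w)).
  by apply: bilin_tens => //; apply: linear_tensl.
have b2 : bilin (fun x y : T => \sum_(v <- bcomul x) v.1 ⊗ (v.2 ⊗ y)).
  apply: (bilin_lift (F := fun x y v => x ⊗ (y ⊗ v))) => //.
    exact: bcomul_linear.
  by move=> x1 y1; apply: linear_tensr; apply: linear_tensr.
have b3 : bilin (fun x y : T => \sum_(v <- bcomul y) x ⊗ (v.1 ⊗ v.2)).
  apply: (bilin_liftr (F := fun x y v => v ⊗ (x ⊗ y))) => //.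
  - exact: bcomul_linear.
  - move=> w; apply: (bilin_comp (h := fun t => w ⊗ t)).
      exact: bilin_tens.
    exact: linear_tensr.
  - by move=> x1 y1; apply: linear_tensl.
move: x; apply: T_ext => [||a g].
- exact: linear_lift b2 bcomul_linear.
- exact: linear_lift b3 bcomul_linear.
have [s sa sU] := eigP (gelt a); have [se sE] := sa.
rewrite (bcomulEg _ sa) (liftE _ _ _ b2) (liftE _ _ _ b3).
transitivity (\sum_(u <- s) \sum_(v <- s)
  (gelt a ⊗ gelt (bold v.1 * (bold u.1 * g))%g) ⊗
  ((v.2 ⊗ gelt (bold u.1 * g)%g) ⊗ (u.2 ⊗ gelt g))).
  by apply: eq_bigr => u _; rewrite (bcomulEg _ sa) (liftE _ _ _ (b1 _)).
pose Psi lam y := (gelt a ⊗ gelt (bold lam * g)%g : T) ⊗ bcomul2 g y.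
have Psil lam : linear (Psi lam).
  by apply: linear_tensr; apply: bcomul2_linear.
transitivity (\sum_(u <- [seq (u.1, comul u.2) | u <- s]) Psi u.1 u.2);
  last first.
  by rewrite big_map; apply: eq_bigr => u _; rewrite tens_sumr bcomulE.
rewrite (@eig_sum _ _ theta2 theta2_linear _ Psi _
  [seq (v.1 * u.1, v.2 ⊗ u.2) | u <- s, v <- s] (gelt a ⊗ gelt a)) //.
- rewrite big_allpairs_dep big_seq [RHS]big_seq; apply: eq_bigr => u us.
  rewrite big_seq [RHS]big_seq; apply: eq_bigr => v vs.
  rewrite /Psi /= (bcomul2E _ _ (se _ us)) boldM ?mulgA //; exact: sU.
- split=> [w /mapP[u us ->] /=|].
    rewrite -[theta2 _]gmap_comul (se _ us); exact: linZ.
  by rewrite big_map -(lin_sum _ _ lcB) -sE gelt_comul.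
- split=> [w /allpairsP[[u v] [/= us vs ->]] /=|].
    rewrite /theta2 (lift1 _ _ th2b) (se _ us) (se _ vs).
    rewrite (linZ ((tens_bilin _ _).1 _)) (linZ ((tens_bilin _ _).2 _)).
    by rewrite scalerA.
  rewrite big_allpairs_dep exchange_big /= [X in X ⊗ _]sE.
  rewrite (lin_sum _ _ ((tens_bilin _ _).1 _)); apply: eq_bigr => v _.
  by rewrite {1}sE (lin_sum _ _ ((tens_bilin _ _).2 _)).
Qed.

Lemma bcounitl x : \sum_(u <- bcomul x) bcounit u.1 *: u.2 = x.
Proof.
have b : bilin (fun x y : T => bcounit x *: y).
  by apply: bilin_scale => //; exact: bcounit_linear.
move: x; apply: T_ext => [||a g]; [exact: linear_lift b bcomul_linear|exact: lidT|].
have [s sa sU] := eigP (gelt a).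
rewrite (bcomulEg _ sa) (liftE _ _ _ b).
rewrite [in RHS]sa.2 (lin_sum _ _ ((tens_bilin _ _).1 _)).
by apply: eq_bigr => u _; rewrite bcounitE !gelt_counit mulr1 scale1r.
Qed.

Lemma counit_theta_eig lam (b : B) :
  gmap theta b = lam *: b -> counit b != 0 -> lam = 1.
Proof.
move=> tb cb; apply: (mulIf cb); rewrite mul1r -[RHS](gmap_counit theta) tb.
by rewrite (@linZ _ _ k^o _ (@counit_linear k B)).
Qed.

Lemma bcounitr x : \sum_(u <- bcomul x) bcounit u.2 *: u.1 = x.
Proof.
have b : bilin (fun x y : T => bcounit y *: x).
  by apply: bilin_swap; apply: bilin_scale => //; exact: bcounit_linear.
move: x; apply: T_ext => [||a g]; [exact: linear_lift b bcomul_linear|exact: lidT|].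
have [s sa sU] := eigP (gelt a).
rewrite (bcomulEg _ sa) (liftE _ _ _ b).
transitivity (\sum_(u <- s) counit u.2 *: (gelt a ⊗ gelt g : T)).
  rewrite big_seq [RHS]big_seq; apply: eq_bigr => u us.
  rewrite bcounitE gelt_counit mulr1.
  have [->|c0] := eqVneq (counit u.2) 0; first by rewrite !scale0r.
  by rewrite (counit_theta_eig (sa.1 _ us) c0) bold1 mul1g.
rewrite -scaler_suml -(@lin_sum _ _ k^o _ _ _ _ (@counit_linear k B)).
by rewrite -sa.2 gelt_counit scale1r.
Qed.

Lemma bcomul1 : bcomul bone = bone ⊗ bone.
Proof.
rewrite boneE bcomulE comul1 (@bcomul2E _ _ 1).
  by rewrite bold1 mul1g.
by rewrite gmap1 scale1r.
Qed.

Lemma bcomulM x y : bcomul (bmul x y) =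
  \sum_(u <- bcomul x) \sum_(v <- bcomul y) bmul u.1 v.1 ⊗ bmul u.2 v.2.
Proof.
have b1 (z w : T) : bilin (fun x y => bmul z x ⊗ bmul w y).
  exact: bilin_tens (mll _) (mll _).
have b2 : bilin (fun z w : T =>
    \sum_(v <- bcomul y) bmul z v.1 ⊗ bmul w v.2).
  apply: (@bilin_sum _ _ _ _ _ _ (fun v z w => bmul z v.1 ⊗ bmul w v.2)) => v.
  exact: bilin_tens (mlr _) (mlr _).
move: x; apply: T_ext => [||a g].
- exact: linear_comp bcomul_linear (mlr _).
- exact: linear_lift b2 bcomul_linear.
have [s sa sU] := eigP (gelt a).
rewrite (bcomulEg _ sa) (liftE _ _ _ b2).
move: y {b2}; apply: T_ext => [||a' g'].
- exact: linear_comp bcomul_linear (mll _).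
- apply: (@sum_linear _ _ _ _ _ (fun u y => \sum_(v <- bcomul y)
    bmul (gelt a ⊗ gelt (bold u.1 * g)%g) v.1 ⊗ bmul (u.2 ⊗ gelt g) v.2)) => u.
  exact: linear_lift (b1 _ _) bcomul_linear.
have [s' sa' sU'] := eigP (gelt a').
set c := (a * pi g a')%g.
have cE : gelt a * gmap (pi g) (gelt a') = gelt c :> B.
  by rewrite gmapE -geltM.
pose t := [seq (u.1 * v.1, u.2 * gmap (pi g) v.2) | u <- s, v <- s'].
have tc : eigen_decomp (gmap theta) t (gelt c).
  split=> [w /allpairsP[[u v] [/= us vs ->]] /=|].
    rewrite gmapM (sa.1 _ us) -pi_theta (sa'.1 _ vs) (linZ (@gmap_linear _ _ _)).
    by rewrite -scalerAr -scalerAl scalerA mulrC.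
  rewrite big_allpairs_dep /= -cE {1}sa.2 mulr_suml; apply: eq_bigr => u _.
  rewrite {1}sa'.2 (lin_sum _ _ (@gmap_linear _ _ _)) mulr_sumr.
  by [].
rewrite bmulE cE (bcomulEg _ tc) big_allpairs_dep big_seq [RHS]big_seq.
apply: eq_bigr => u us; rewrite (bcomulEg _ sa') (liftE _ _ _ (b1 _ _)).
rewrite big_seq [RHS]big_seq; apply: eq_bigr => v vs.
have Uu := sU _ us; have Uv := sU' _ vs.
rewrite !bmulE /= boldM // piE (bold_pi Uu) gmap_id cE; congr ((_ ⊗ gelt _) ⊗ _).
by rewrite -!mulgA; congr (_ * _)%g; rewrite !mulgA bold_central.
Qed.

Lemma bcounit1 : bcounit bone = 1.
Proof. by rewrite bcounitE !counit1 mulr1. Qed.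

Lemma bcounitM x y : bcounit (bmul x y) = bcounit x * bcounit y.
Proof.
have lc := bcounit_linear.
move: x; apply: (@T_ext k^o) => [||a g].
- exact: (@linear_comp _ _ _ k^o _ _ lc (mlr _)).
- by move=> e x z; rewrite lc mulrDl scalerAl.
move: y; apply: (@T_ext k^o) => [||a' g'].
- exact: (@linear_comp _ _ _ k^o _ _ lc (mll _)).
- by move=> e x z; rewrite lc mulrDr scalerAr.
by rewrite bmulE gmapE -geltM !bcounitE !gelt_counit !mulr1.
Qed.

Let ba0 (h : H) : bilin (fun c1 c2 =>
  bmul (1 ⊗ antipode (c1 * h)) (antipode c2 ⊗ 1)).
Proof.
have la1 : linear (fun c1 : H => 1 ⊗ antipode (c1 * h) : T).
  apply: linear_tensr; apply: (linear_comp (@antipode_linear k H)).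
  exact: linear_mull lidH.
have la2 : linear (fun c2 : B => antipode c2 ⊗ 1 : T).
  by apply: linear_tensl; exact: antipode_linear.
split=> z; first exact: linear_comp (mlr _) la1.
exact: linear_comp (mll _) la2.
Qed.

Let ba1 : bilin (fun (p : B) (h : H) => \sum_(c <- coact p)
  bmul (1 ⊗ antipode (c.1 * h)) (antipode c.2 ⊗ 1)).
Proof.
apply: (bilin_lift (F := fun c1 c2 h =>
  bmul (1 ⊗ antipode (c1 * h)) (antipode c2 ⊗ 1))) => //.
  exact: coact_linear.
move=> c1 c2; apply: (linear_comp (mlr _)); apply: linear_tensr.
apply: (linear_comp (@antipode_linear k H)); exact: linear_mulr lidH.
Qed.

Lemma bantipode_linear : linear bantipode. Proof. exact: lift_linear ba1. Qed.

Lemma bantipodeE lam b g : gmap theta b = lam *: b ->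
  bantipode (b ⊗ gelt g) =
  gmap (pi (bold lam * g)^-1%g) (antipode b) ⊗ gelt (bold lam * g)^-1%g.
Proof.
move=> tb; rewrite /bantipode (lift1 _ _ ba1) (coact_eig tb).
rewrite (lift1 _ _ (ba0 _)) -geltM gelt_antipode.
by rewrite -[bmul _ _]/(bmul _ (_ ⊗ gelt 1%g)) bmulE mulg1 mul1r.
Qed.

Lemma bantipodel x :
  \sum_(u <- bcomul x) bmul (bantipode u.1) u.2 = bcounit x *: bone.
Proof.
have b : bilin (fun x y => bmul (bantipode x) y).
  split=> z; first exact: linear_comp (mlr _) bantipode_linear.
  exact: mll.
move: x; apply: T_ext => [||a g].
- exact: linear_lift b bcomul_linear.
- exact: scalar_linear bcounit_linear.
have [s sa sU] := eigP (gelt a).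
rewrite (bcomulEg _ sa) (liftE _ _ _ b) bcounitE !gelt_counit mulr1 scale1r.
pose Phi lam y : T := gmap (pi g^-1%g) y ⊗ gelt (bold lam)^-1%g.
have Phil lam : linear (Phi lam).
  by apply: linear_tensl; apply: gmap_linear.
transitivity (\sum_(w <-
    [seq (v.1 * u.1, antipode v.2 * u.2) | u <- s, v <- s]) Phi w.1 w.2).
  rewrite big_allpairs_dep big_seq [RHS]big_seq; apply: eq_bigr => u us.
  rewrite [X in X ⊗ gelt (bold _ * _)%g]sa.2.
  rewrite (lin_sum _ _ ((tens_bilin _ _).1 _)).
  rewrite (lin_sum _ _ bantipode_linear) (lin_sum _ _ (mlr _)).
  rewrite big_seq [RHS]big_seq; apply: eq_bigr => v vs.
  have Uu := sU _ us; have Uv := sU _ vs.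
  rewrite (bantipodeE _ (sa.1 _ vs)) bmulE -gmapM mulgA -boldM // /Phi /=.
  set mu := v.1 * u.1; have Umu : U mu by have [_ _ h _] := U_subgroup; apply: h.
  rewrite bold_central // invgM mulgVK; congr (_ ⊗ _).
  rewrite piE (_ : pi (bold mu)^-1%g = 1%g) ?gmap_id //.
  apply: (can_inj (mulKg (pi (bold mu)))).
  by rewrite -piM mulgV pi1 mulg1 bold_pi.
rewrite (@eig_sum _ _ _ thl _ Phi _ [:: (1, 1)] 1) //.
- by rewrite big_seq1 /Phi /= gmap1 bold1 invg1.
- split=> [w /allpairsP[[u v] [/= us vs ->]] /=|].
    rewrite gmapM gmap_antipode (sa.1 _ us) (sa.1 _ vs).
    by rewrite (linZ (@antipode_linear k B)) -scalerAr -scalerAl scalerA mulrC.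
  rewrite big_allpairs_dep exchange_big /=.
  rewrite -[LHS](gelt1 k GG) -(mulVg a) geltM -gelt_antipode.
  rewrite {1}sa.2 (lin_sum _ _ (@antipode_linear k B)) mulr_suml.
  by apply: eq_bigr => v _; rewrite {1}sa.2 mulr_sumr.
- split=> [w|]; last by rewrite big_seq1.
  by rewrite inE => /eqP -> /=; rewrite gmap1 scale1r.
Qed.

Lemma bantipoder x :
  \sum_(u <- bcomul x) bmul u.1 (bantipode u.2) = bcounit x *: bone.
Proof.
have b : bilin (fun x y => bmul x (bantipode y)).
  split=> z; last exact: linear_comp (mll _) bantipode_linear.
  exact: mlr.
move: x; apply: T_ext => [||a g].
- exact: linear_lift b bcomul_linear.
- exact: scalar_linear bcounit_linear.
have [s sa sU] := eigP (gelt a).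
rewrite (bcomulEg _ sa) (liftE _ _ _ b) bcounitE !gelt_counit mulr1 scale1r.
transitivity (\sum_(u <- s) (gelt a * antipode u.2) ⊗ (1 : H) : T).
  rewrite big_seq [RHS]big_seq; apply: eq_bigr => u us.
  rewrite (bantipodeE _ (sa.1 _ us)) bmulE -piE mulgV pi1 gmap_id.
  by rewrite gelt1.
rewrite -(lin_sum _ _ ((tens_bilin _ _).1 _)) -mulr_sumr.
rewrite -(lin_sum _ _ (@antipode_linear k B)) -sa.2 gelt_antipode -geltM mulgV.
by rewrite gelt1.
Qed.

HB.instance Definition _ := GRing.Lmodule.copy (biproduct D) T.
HB.instance Definition _ := GRing.Zmodule_isNzRing.Build (biproduct D)
  bmulA bmul1 bmulr1 bmulDl bmulDr bone_neq0.

Lemma bscaleAl (a : k) (x y : biproduct D) : a *: (x * y) = (a *: x) * y.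
Proof. exact: esym (linZ (mlr y) a x). Qed.
Lemma bscaleAr (a : k) (x y : biproduct D) : a *: (x * y) = x * (a *: y).
Proof. exact: esym (linZ (mll x) a y). Qed.

HB.instance Definition _ := GRing.Lmodule_isLalgebra.Build k (biproduct D) bscaleAl.
HB.instance Definition _ := GRing.Lalgebra_isAlgebra.Build k (biproduct D) bscaleAr.

HB.instance Definition _ := isHopf.Build k (biproduct D)
  bcomul_linear bcounit_linear bantipode_linear bcomulA bcounitl bcounitr
  bcomul1 bcomulM bcounit1 bcounitM bantipodel bantipoder.

End Biproduct.

(* Main.v *)
Require Import Defs.
From HB Require Import structures.
From mathcomp Require Import all_boot all_order all_algebra.
From mathcomp Require Import boolp classical_sets functions cardinality.
From mathcomp Require Import generic_quotient.

Set Implicit Arguments.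
Unset Strict Implicit.
Unset Printing Implicit Defensive.

Import GRing.Theory.
Local Open Scope classical_set_scope.
Local Open Scope quotient_scope.
Local Open Scope ring_scope.

(** Write [A] for the biproduct of [B = k[GG]] and [H = k[G]], and [k[U]] for
    the span in [A] of the elements [1 ⊗ u] with [u] in [U].  The theorem holds
    because of the chain

      [k ⊆ k[U] ⊆ A],

    which has length two.

    The elements [1 ⊗ u] are grouplike, so that [k[U]] is a Hopf subalgebra
    isomorphic to the group algebra of [U] ([ualg_subalgebra],
    [ualg_incl_inj]).  They are also central in [A], as [U] is central in [G]
    and acts trivially on [GG] ([ualg_central]); the adjoint actions on a
    central Hopf subalgebra are trivial, hence [k[U]] is normal
    ([central_normal]).

    The coaction is the only thing that prevents [A] from being cocommutative:
    if [a] in [GG] is the sum of eigenvectors [a_λ] of [theta], then the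
    coproduct of [a ⊗ g] is the sum of the [(a ⊗ bold λ * g) ⊗ (a_λ ⊗ g)].
    Modulo [k[U]^+ A] every [bold λ] becomes [1], the sum over [λ] recovers [a],
    and the class of [a ⊗ g] becomes grouplike.  The multiplication of [A] is
    that of the semidirect product of [GG] by [G] on the elements [a ⊗ g], so
    that [A / k[U]^+ A] is the group algebra of the quotient of this semidirect
    product by the normal subgroup [1 × U] ([proj_hopf], [proj_kernel]).  Group
    algebras are cocommutative, which settles both factors. *)

(** * Subgroups, quotients and semidirect products as group types *)

Section Subgroup.
Context (G : groupType) (S : set G) (hS : is_subgroup S).

(** The type carries the proof [hS] so that the group structure below can be
    inferred from the type alone. *)
Definition subgroup_type of is_subgroup S : Type := {x : G | `[< S x >]}.
Local Notation sT := (subgroup_type hS).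

HB.instance Definition _ := Choice.on sT.
HB.instance Definition _ := SubType.on sT.

Implicit Types x y z : sT.

Lemma subgroup_valP x : S (val x).
Proof. by case: x => x /= /asboolP. Qed.

Definition subgroup_elt (g : G) (Sg : S g) : sT := exist _ g (asboolT Sg).

Definition subgroup_one : sT := subgroup_elt (let: And3 h _ _ := hS in h).
Definition subgroup_mul x y : sT :=
  subgroup_elt (let: And3 _ h _ := hS in
    h _ _ (subgroup_valP x) (subgroup_valP y)).
Definition subgroup_inv x : sT :=
  subgroup_elt (let: And3 _ _ h := hS in h _ (subgroup_valP x)).

Lemma subgroup_mulA : associative subgroup_mul.
Proof. by move=> x y z; apply: val_inj; rewrite /= mulgA. Qed.
Lemma subgroup_mul1 : left_id subgroup_one subgroup_mul.
Proof. by move=> x; apply: val_inj; rewrite /= mul1g. Qed.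
Lemma subgroup_mulr1 : right_id subgroup_one subgroup_mul.
Proof. by move=> x; apply: val_inj; rewrite /= mulg1. Qed.
Lemma subgroup_mulV : left_inverse subgroup_one subgroup_inv subgroup_mul.
Proof. by move=> x; apply: val_inj; rewrite /= mulVg. Qed.
Lemma subgroup_mulrV : right_inverse subgroup_one subgroup_inv subgroup_mul.
Proof. by move=> x; apply: val_inj; rewrite /= mulgV. Qed.

HB.instance Definition _ := isGroup.Build sT subgroup_mulA
  subgroup_mul1 subgroup_mulr1 subgroup_mulV subgroup_mulrV.

End Subgroup.

Section QuotientGroup.
Context (G : groupType) (N : set G).

Definition is_normal_subgroup :=
  is_subgroup N /\ forall g x, N x -> N (g^-1 * x * g)%g.

Hypothesis hN : is_normal_subgroup.

Definition coset_rel (x y : G) : bool := `[< N (x^-1 * y)%g >].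

Lemma coset_rel_equiv : equiv_class_of coset_rel.
Proof.
have [[N1 NM NV] _] := hN; rewrite /coset_rel; split=> [x|x y|y x z].
- by apply/asboolP; rewrite mulVg.
- by apply/asboolP/asboolP => /NV; rewrite invgM invgK.
- move=> /asboolP xy /asboolP yz; apply/asboolP.
  by have := NM _ _ xy yz; rewrite mulgA mulgK.
Qed.

Canonical coset_equiv := EquivRelPack coset_rel_equiv.

Definition quotient_group : Type := {eq_quot coset_equiv}.
HB.instance Definition _ := Choice.on quotient_group.
HB.instance Definition _ := EqQuotient.on quotient_group.

Definition coset_class (x : G) : quotient_group := \pi_quotient_group x.
Local Notation "[ x ]" := (coset_class x).

Lemma coset_classP x y : [x] = [y] <-> N (x^-1 * y)%g.
Proof.
split=> [/(@eqquotP _ _ quotient_group)/asboolP//|h].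
by apply/(@eqquotP _ _ quotient_group)/asboolP.
Qed.

Lemma coset_reprK (q : quotient_group) : [repr q] = q.
Proof. exact: reprK. Qed.

Lemma coset_classM x x' y y' : [x] = [x'] -> [y] = [y'] ->
  [(x * y)%g] = [(x' * y')%g].
Proof.
have [[_ NM _] nN] := hN.
move=> /coset_classP xx /coset_classP yy; apply/coset_classP.
have := NM _ _ (nN y _ xx) yy.
by rewrite invgM !mulgA mulgK.
Qed.

Definition quo_mul (p q : quotient_group) := [(repr p * repr q)%g].
Definition quo_inv (p : quotient_group) := [((repr p)^-1)%g].
Definition quo_one : quotient_group := [1%g].

Lemma quo_mulE x y : quo_mul [x] [y] = [(x * y)%g].
Proof. by apply: coset_classM; rewrite coset_reprK. Qed.

Lemma quo_mulA : associative quo_mul.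
Proof.
move=> p q r; rewrite -[p]coset_reprK -[q]coset_reprK -[r]coset_reprK.
by rewrite !quo_mulE mulgA.
Qed.
Lemma quo_mul1 : left_id quo_one quo_mul.
Proof. by move=> p; rewrite -[p]coset_reprK quo_mulE mul1g. Qed.
Lemma quo_mulr1 : right_id quo_one quo_mul.
Proof. by move=> p; rewrite -[p]coset_reprK quo_mulE mulg1. Qed.
Lemma quo_mulV : left_inverse quo_one quo_inv quo_mul.
Proof. by move=> p; rewrite -{2}[p]coset_reprK quo_mulE mulVg. Qed.
Lemma quo_mulrV : right_inverse quo_one quo_inv quo_mul.
Proof. by move=> p; rewrite -{1}[p]coset_reprK quo_mulE mulgV. Qed.

HB.instance Definition _ := isGroup.Build quotient_group
  quo_mulA quo_mul1 quo_mulr1 quo_mulV quo_mulrV.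

Lemma coset_class_mul x y : [(x * y)%g] = ([x] * [y])%g.
Proof. exact: esym (quo_mulE x y). Qed.

Lemma coset_class_inv x : [x^-1%g] = ([x])^-1%g.
Proof.
by apply: (mulIg [x]); rewrite mulVg -coset_class_mul mulVg.
Qed.

End QuotientGroup.

Lemma multiplicative1 (G1 G2 : groupType) (f : {multiplicative G1 -> G2}) :
  f 1%g = 1%g.
Proof. by apply: (mulgI (f 1%g)); rewrite -gmulfM !mulg1. Qed.

Section SemidirectProduct.
Context (G K : groupType) (pi : {multiplicative G -> groupAut K}).

(** The action is a parameter of the type because the multiplication of pairs
    depends on it. *)
Definition semidirect of {multiplicative G -> groupAut K} : Type := (K * G)%type.
Local Notation P := (semidirect pi).
HB.instance Definition _ := Choice.on P.

Implicit Types x y z : P.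

Definition sd_mul x y : P := ((x.1 * pi x.2 y.1)%g, (x.2 * y.2)%g).
Definition sd_one : P := (1%g, 1%g).
Definition sd_inv x : P := (pi x.2^-1%g x.1^-1%g, x.2^-1%g).

Lemma sd_mulA : associative sd_mul.
Proof. by move=> x y z; rewrite /sd_mul /= autM gmulfM !mulgA. Qed.
Lemma sd_mul1 : left_id sd_one sd_mul.
Proof. by case=> a g; rewrite /sd_mul /= multiplicative1 !mul1g. Qed.
Lemma sd_mulr1 : right_id sd_one sd_mul.
Proof. by case=> a g; rewrite /sd_mul /= aut1 !mulg1. Qed.
Lemma sd_mulV : left_inverse sd_one sd_inv sd_mul.
Proof. by case=> a g; rewrite /sd_mul /= -autM !mulVg aut1. Qed.
Lemma sd_mulrV : right_inverse sd_one sd_inv sd_mul.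
Proof.
case=> a g; rewrite /sd_mul /= -aut_mulE -gmulfM !mulgV multiplicative1.
by rewrite aut_oneE mulgV.
Qed.

HB.instance Definition _ := isGroup.Build P
  sd_mulA sd_mul1 sd_mulr1 sd_mulV sd_mulrV.

End SemidirectProduct.

Section LRMorphism.
Context (k : fieldType) (A Q : algType k) (f : A -> Q).
Hypotheses (fl : linear f) (f1 : f 1 = 1) (fM : {morph f : x y / x * y}).

(** The map [f] itself, tagged with the proofs that make it a morphism of
    algebras. *)
Definition alg_hom of linear f & f 1 = 1 & {morph f : x y / x * y} := f.
HB.instance Definition _ :=
  GRing.isLinear.Build k A Q *:%R (alg_hom fl f1 fM) fl.
HB.instance Definition _ :=
  GRing.isMonoidMorphism.Build A Q (alg_hom fl f1 fM) (f1, fM).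

End LRMorphism.

(** * Hopf algebras *)

Section HopfGeneralities.
Context (k : fieldType).

(** A substitute for [galg_ext] when the goal is membership in a subspace
    instead of an equality of linear maps. *)
Lemma galg_span (K : groupType) (C : set (galg k K)) : C 0 ->
  (forall c x y, C x -> C y -> C (c *: x + y)) ->
  (forall g, C (gelt g)) -> forall x, C x.
Proof.
move=> C0 CL Cg x; rewrite [x]galgE /gext.
by apply: big_rec => // g y _; apply: CL.
Qed.

Lemma hopf_morphism_id (A : hopfAlgType k) :
  hopf_morphism (idfun : {lrmorphism A -> A}).
Proof. by split=> // a; rewrite -tensE. Qed.

Lemma hopf_morphism_range (A Q : hopfAlgType k) (f : {lrmorphism A -> Q}) :
  hopf_morphism f -> hopf_subalgebra (range f).
Proof.
move=> [fD _ fS]; split.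
- by move=> c _ _ [x _ <-] [y _ <-]; exists (c *: x + y); rewrite ?linearP.
- split=> [|_ _ [x _ <-] [y _ <-]]; first by exists 1; rewrite ?rmorph1.
  by exists (x * y); rewrite ?rmorphM.
- move=> _ [x _ <-]; rewrite fD.
  exists [seq (f u.1, f u.2) | u <- comul x]; last by rewrite big_map.
  by move=> _ /mapP[u _ ->]; split; [exists u.1|exists u.2].
- by move=> _ [x _ <-]; exists (antipode x); rewrite ?fS.
Qed.

Lemma antipode1 (A : hopfAlgType k) : antipode (1 : A) = 1.
Proof.
have b := bilin_mul (@antipode_linear k A) (@linear_id k A).
by have := antipodel (1 : A); rewrite comul1 (lift1 _ _ b) mulr1 counit1 scale1r.
Qed.

Lemma scalars_subalgebra (A : hopfAlgType k) :
  hopf_subalgebra (range (fun c : k => c *: (1 : A))).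
Proof.
split.
- move=> c _ _ [x _ <-] [y _ <-]; exists (c * x + y) => //.
  by rewrite scalerDl scalerA.
- split=> [|_ _ [x _ <-] [y _ <-]]; first by exists 1; rewrite ?scale1r.
  by exists (x * y); rewrite // -scalerAl mul1r scalerA.
- move=> _ [c _ <-]; exists [:: (c *: 1, 1)].
    move=> u; rewrite inE => /eqP -> /=; split; first by exists c.
    by exists 1; rewrite ?scale1r.
  rewrite big_seq1 (linZ (@comul_linear k A)) comul1.
  by rewrite (linZ ((tens_bilin _ _).1 _)).
- move=> _ [c _ <-]; exists c => //.
  by rewrite (linZ (@antipode_linear k A)) antipode1.
Qed.

(** A central [x] can be pulled out of [a_(1) x S(a_(2))], which leaves
    [ε(a) x] by the antipode axiom. *)
Lemma central_normal (A : hopfAlgType k) (L K : set A) :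
  (forall a x, L x -> a * x = x * a) ->
  (forall c x, L x -> L (c *: x)) -> normal_in L K.
Proof.
move=> Lc LZ a x _ Lx; split.
- under eq_bigr => u _ do rewrite (Lc _ _ Lx) -mulrA.
  by rewrite -mulr_sumr antipoder -scalerAr mulr1; apply: LZ.
- under eq_bigr => u _ do rewrite (Lc _ _ Lx) -mulrA.
  by rewrite -mulr_sumr antipodel -scalerAr mulr1; apply: LZ.
Qed.

Lemma aug_ideal_linear (A : hopfAlgType k) (L K : set A) c x y :
  (forall c x, K x -> K (c *: x)) ->
  aug_ideal L K x -> aug_ideal L K y -> aug_ideal L K (c *: x + y).
Proof.
move=> KZ [s sP ->] [t tP ->].
exists ([seq (u.1, c *: u.2) | u <- s] ++ t).
  move=> u; rewrite mem_cat => /orP[/mapP[v /sP[Lv cv Kv] ->]|/tP//].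
  by split=> //; apply: KZ.
rewrite big_cat big_map scaler_sumr; congr (_ + _).
by apply: eq_bigr => u _; rewrite scalerAr.
Qed.

(** The augmentation ideal of the scalars is zero, so that a Hopf algebra is its
    own factor by the bottom of a lower normal series. *)
Lemma aug_ideal_scalars (A : hopfAlgType k) (K : set A) z :
  aug_ideal (range (fun c : k => c *: (1 : A))) K z -> z = 0.
Proof.
move=> [s sP ->]; rewrite big_seq big1 // => u /sP[[c _ <-] cu _].
move: cu; rewrite (@linZ k A k^o _ (@counit_linear k A)) counit1.
by rewrite [_ *: _]mulr1 => ->; rewrite scale0r mul0r.
Qed.

Lemma galg_cocommutative (K : groupType) : cocommutative (galg k K).
Proof.
have lD := @comul_linear k (galg k K).
have b : bilin (fun x y : galg k K => y ⊗ x) by apply/bilin_swap/tens_bilin.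
apply: galg_ext; [exact: lD|exact: linear_lift b lD|move=> g].
by rewrite gelt_comul (lift1 _ _ b).
Qed.

End HopfGeneralities.

(** A group morphism into the grouplike elements of a Hopf algebra extends to a
    Hopf morphism on the group algebra. *)
Section GroupLikeExtension.
Context (k : fieldType) (K : groupType) (A : hopfAlgType k) (phi : K -> A).
Hypothesis phi1 : phi 1%g = 1.
Hypothesis phiM : {morph phi : x y / (x * y)%g >-> x * y}.

Lemma gext_one : gext phi 1 = 1.
Proof. by rewrite -gelt1 gext1. Qed.

Lemma gext_mul : {morph gext phi : x y / x * y}.
Proof.
have lp := gext_linear phi; have lid := @linear_id k (galg k K).
move=> x y; move: x; apply: galg_ext => [||g].
- exact: linear_comp lp (linear_mull _ lid).
- exact: linear_mull _ lp.
move: y; apply: galg_ext => [||h].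
- exact: linear_comp lp (linear_mulr _ lid).
- exact: linear_mulr _ lp.
by rewrite -geltM !gext1.
Qed.

Definition galg_hom : {lrmorphism galg k K -> A} :=
  alg_hom (gext_linear phi) gext_one gext_mul.

Lemma galg_homE g : galg_hom (gelt g) = phi g.
Proof. exact: gext1. Qed.

Lemma galg_hom_hopf :
  (forall g, comul (phi g) = phi g ⊗ phi g) -> (forall g, counit (phi g) = 1) ->
  hopf_morphism galg_hom.
Proof.
move=> phiD phie.
have lp : linear galg_hom := gext_linear phi.
have lD := @comul_linear k (galg k K); have b := bilin_tens lp lp.
split=> a.
- move: a; apply: galg_ext => [||g].
  + exact: linear_comp (@comul_linear k A) lp.
  + exact: linear_lift b lD.
  by rewrite gelt_comul (lift1 _ _ b) !galg_homE.
- move: a; apply: (@galg_ext k K k^o) => [||g].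
  + exact: (@linear_comp _ _ _ k^o _ _ (@counit_linear k A) lp).
  + exact: counit_linear.
  by rewrite galg_homE phie gelt_counit.
- move: a; apply: galg_ext => [||g].
  + exact: linear_comp lp (@antipode_linear k _).
  + exact: linear_comp (@antipode_linear k A) lp.
  rewrite gelt_antipode !galg_homE.
  (* The antipode of a grouplike element is its inverse. *)
  have: antipode (phi g) * phi g = 1.
    have b' := bilin_mul (@antipode_linear k A) (@linear_id k A).
    by have := antipodel (phi g); rewrite phiD phie scale1r (lift1 _ _ b').
  move=> /(congr1 (fun z => z * phi g^-1%g)).
  by rewrite /= -mulrA -phiM mulgV phi1 mulr1 mul1r.
Qed.

End GroupLikeExtension.

(** * The central Hopf subalgebra k[U] of the biproduct *)

Section BiproductSeries.
Context (k : fieldType) (G GG : groupType) (D : biproduct_datum k G GG).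
Local Notation B := (galg k GG).
Local Notation H := (galg k G).
Local Notation A := (biproduct D).
Local Notation pi := (bd_pi D).
Local Notation bold := (bd_bold D).
Local Notation U := (bd_U D).
Local Notation UT := (subgroup_type (bd_subgroup D)).

Lemma biproductM b g b' g' : (b ⊗ gelt g : A) * (b' ⊗ gelt g' : A) =
  (b * gmap (pi g) b') ⊗ gelt (g * g')%g.
Proof. exact: bmulE. Qed.

Lemma biproduct_span (C : set A) : C 0 ->
  (forall c x y, C x -> C y -> C (c *: x + y)) ->
  (forall a g, C (gelt a ⊗ gelt g)) -> forall x, C x.
Proof.
move=> C0 CL Cg x; rewrite [x]tensE; apply: big_rec => // u y _ Cy.
rewrite -[X in X + _]scale1r; apply: (CL) => {y Cy} //.
have [tl tr] := tens_bilin B H.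
pose C1 b := C (b ⊗ u.2); apply: (galg_span (C := C1)) => [|c b b' Cb Cb'|a].
- by rewrite /C1 (lin0 (tl _)).
- by rewrite /C1 tl; apply: CL.
pose C2 h := C (gelt a ⊗ h); apply: (galg_span (C := C2)) => [|c h h' Ch Ch'|g].
- by rewrite /C2 (lin0 (tr _)).
- by rewrite /C2 tr; apply: CL.
exact: Cg.
Qed.

Definition ulike (u : UT) : A := 1 ⊗ gelt (val u).

Lemma ulikeM : {morph ulike : x y / (x * y)%g >-> x * y}.
Proof. by move=> x y; rewrite /ulike biproductM gmap1 mulr1. Qed.

Lemma ulike_comul u : comul (ulike u) = ulike u ⊗ ulike u.
Proof.
rewrite -[LHS]/(bcomul D _) /ulike bcomulE comul1 (@bcomul2E _ _ _ D _ _ 1).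
  by rewrite bold1 mul1g.
by rewrite gmap1 scale1r.
Qed.

Lemma ulike_counit u : counit (ulike u) = 1.
Proof.
by rewrite -[LHS]/(bcounit _) /ulike bcounitE counit1 gelt_counit mulr1.
Qed.

Definition ualg_incl := galg_hom (phi := ulike) erefl ulikeM.

Lemma ualg_incl_hopf : hopf_morphism ualg_incl.
Proof. exact: galg_hom_hopf ulike_comul ulike_counit. Qed.

(** A left inverse applies the counit to the first tensor factor and kills the
    elements of [G] outside [U] in the second one. *)
Lemma ualg_incl_inj : injective ualg_incl.
Proof.
pose r (b : B) (h : H) : galg k UT :=
  counit b *: gext (fun g => oapp gelt 0 (insub g : option UT)) h.
have rb : bilin r.
  by apply: bilin_scale; [exact: counit_linear | exact: gext_linear].
pose ret (x : (B ⊗ H)%type) := \sum_(u <- x) r u.1 u.2.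
have retK z : ret (ualg_incl z) = z.
  move: z; apply: galg_ext => [||u].
  - exact: linear_comp (lift_linear rb) (gext_linear ulike).
  - exact: linear_id.
  transitivity (ret (ulike u)); first exact: congr1 (galg_homE _ _ u).
  by rewrite /ret (lift1 _ _ rb) /r counit1 scale1r gext1 valK.
exact: can_inj retK.
Qed.

Definition ualg : set A := range ualg_incl.

Lemma ualg_subalgebra : hopf_subalgebra ualg.
Proof. exact: hopf_morphism_range ualg_incl_hopf. Qed.

Lemma ulike_central u (a : A) : a * ulike u = ulike u * a.
Proof.
have [pu cu] : [set g | pi g = 1%g] (val u) /\ group_center G (val u).
  exact: (bd_ker (subgroup_valP u)).
have ml := linear_mull (ulike u) (@linear_id k A).
have mr := linear_mulr (ulike u) (@linear_id k A).
move: a; apply: (T_ext1 ml mr) => b g.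
rewrite /ulike !biproductM gmap1 mulr1 mul1r.
by rewrite [pi _]pu gmap_id cu.
Qed.

Lemma ualg_central (a x : A) : ualg x -> a * x = x * a.
Proof.
move=> [z _ <-]; have ul : linear ualg_incl := gext_linear ulike.
move: z; apply: galg_ext => [||u].
- exact: linear_mulr _ ul.
- exact: linear_mull _ ul.
by rewrite galg_homE ulike_central.
Qed.

(** * The quotient of the biproduct by k[U] *)

Local Notation P := (semidirect pi).

Definition ukernel : set P := [set x | x.1 = 1%g /\ U x.2].

Lemma ukernel_normal : is_normal_subgroup ukernel.
Proof.
have [U1 UM UV] := bd_subgroup D.
split; first split.
- by split.
- move=> [a g] [b h] [/= -> Ug] [/= -> Uh]; split=> /=; last exact: UM.
  by rewrite aut1 mulg1.
- move=> [a g] [/= -> Ug]; split=> /=; last exact: UV.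
  by rewrite invg1 aut1.
move=> [a g] [b u] [/= -> Uu].
have [pu cu] : [set g | pi g = 1%g] u /\ group_center G u := bd_ker Uu.
split=> /=; last by rewrite -mulgA cu mulgA mulVg mul1g.
by rewrite aut1 mulg1 gmulfM pu mulg1 -autM mulVg aut1.
Qed.

Local Notation PU := (quotient_group ukernel_normal).
Local Notation "[ x ]" := (coset_class ukernel_normal x).

Let fproj (b : B) (h : H) : galg k PU :=
  gext (fun a => gext (fun g => gelt [(a, g) : P]) h) b.

Definition proj_fun (x : A) : galg k PU :=
  \sum_(u <- (x : (B ⊗ H)%type)) fproj u.1 u.2.

Let fproj_bilin : bilin fproj.
Proof.
split=> [h|b]; first exact: gext_linear.
by apply: gext_sum_linear => a; apply: gext_linear.
Qed.

Lemma proj_linear : linear proj_fun.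
Proof. exact: lift_linear fproj_bilin. Qed.

Lemma proj_funE a g : proj_fun (gelt a ⊗ gelt g) = gelt [(a, g) : P].
Proof. by rewrite /proj_fun (lift1 _ _ fproj_bilin) /fproj !gext1. Qed.

(** The projection forgets the coaction: multiplying the second tensor factor by
    some [bold λ] does not change the image. *)
Lemma proj_U b g u : U u ->
  proj_fun (b ⊗ gelt (u * g)%g) = proj_fun (b ⊗ gelt g).
Proof.
move=> Uu; have lb h : linear (fun b : B => proj_fun (b ⊗ h)).
  exact: linear_comp proj_linear (linear_tensl _ (@linear_id k B)).
move: b; apply: (galg_ext (lb _) (lb _)) => a; rewrite !proj_funE; congr gelt.
have [_ _ UV] := bd_subgroup D.
have [_ cu] := bd_ker (UV _ Uu).
apply/coset_classP; split=> /=; first by rewrite -autM mulVg aut1.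
by rewrite invgM -mulgA cu mulKg; apply: UV.
Qed.

Lemma proj1 : proj_fun 1 = 1.
Proof. exact: proj_funE 1%g 1%g. Qed.

Lemma projM : {morph proj_fun : x y / x * y}.
Proof.
have lp := proj_linear; have lid := @linear_id k A.
move=> x y; move: x; apply: T_ext => [||a g].
- exact: linear_comp lp (linear_mull _ lid).
- exact: linear_mull _ lp.
move: y; apply: T_ext => [||b h].
- exact: linear_comp lp (linear_mulr _ lid).
- exact: linear_mulr _ lp.
rewrite biproductM gmapE -geltM !proj_funE -geltM; congr gelt.
exact: (coset_class_mul ukernel_normal ((a, g) : P) ((b, h) : P)).
Qed.

Definition proj : {lrmorphism A -> galg k PU} :=
  alg_hom proj_linear proj1 projM.

(** After [proj_U], each sum over the eigencomponents of [gelt a] collapses to a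
    value at [gelt a], and the images of the [gelt a ⊗ gelt g] are grouplike
    as in a group algebra. *)
Lemma proj_hopf : hopf_morphism proj.
Proof.
have lp : linear (proj_fun : (B ⊗ H)%type -> _) := proj_linear.
have b := bilin_tens lp lp.
split=> x.
- move: x; apply: T_ext => [||a g].
  + exact: linear_comp (@comul_linear k _) lp.
  + exact: (linear_lift b (@bcomul_linear k G GG D)).
  have [s sa sU] := eigP D (gelt a).
  transitivity (\sum_(u <- bcomul D (gelt a ⊗ gelt g))
      proj_fun u.1 ⊗ proj_fun u.2); last by [].
  rewrite (bcomulEg _ sa) (liftE _ _ _ b).
  transitivity (proj_fun (gelt a ⊗ gelt g) ⊗
    \sum_(u <- s) proj_fun (u.2 ⊗ gelt g)).
    rewrite -(lin_sum _ _ (linear_comp lp (linear_tensl _ (@linear_id k B)))).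
    by rewrite -sa.2 -[proj _]/(proj_fun _) proj_funE gelt_comul.
  rewrite (lin_sum _ _ ((tens_bilin _ _).2 _)).
  rewrite big_seq [RHS]big_seq; apply: eq_bigr => u us.
  by rewrite proj_U //; apply: bold_U; apply: sU.
- move: x; apply: (@T_ext k G GG k^o) => [||a g].
  + exact: (@linear_comp _ _ _ k^o _ _ (@counit_linear k _) lp).
  + exact: (@bcounit_linear k G GG).
  rewrite -[proj _]/(proj_fun _) proj_funE gelt_counit.
  by rewrite -[RHS]/(bcounit _) bcounitE !gelt_counit mulr1.
- move: x; apply: T_ext => [||a g].
  + exact: linear_comp lp (@bantipode_linear k G GG D).
  + exact: linear_comp (@antipode_linear k _) lp.
  transitivity (proj_fun (bantipode D (gelt a ⊗ gelt g))); first by [].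
  rewrite -[proj _]/(proj_fun _) proj_funE gelt_antipode.
  have [s sa sU] := eigP D (gelt a).
  rewrite [X in X ⊗ _]sa.2 (lin_sum _ _ ((tens_bilin _ _).1 _)).
  rewrite (lin_sum _ _ (@bantipode_linear k G GG D)) (lin_sum _ _ lp).
  transitivity (\sum_(u <- s)
    proj_fun (gmap (pi g^-1%g) (antipode u.2) ⊗ gelt g^-1%g)).
    rewrite big_seq [RHS]big_seq; apply: eq_bigr => u us.
    rewrite (bantipodeE _ (sa.1 _ us)) invgM.
    have Uv : U (bold u.1)^-1%g.
      by have [_ _ h] := bd_subgroup D; apply/h/bold_U; exact: sU us.
    have [pu cu] := bd_ker Uv.
    by rewrite -cu proj_U // gmulfM pu mul1g.
  have lq : linear (fun y : B =>
      proj_fun (gmap (pi g^-1%g) (antipode y) ⊗ gelt g^-1%g)).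
    apply: linear_comp lp (linear_tensl _ _).
    exact: linear_comp (@gmap_linear k GG _) (@antipode_linear k B).
  rewrite -(lin_sum _ _ lq) -sa.2 gelt_antipode gmapE proj_funE; congr gelt.
  exact: (coset_class_inv ukernel_normal ((a, g) : P)).
Qed.

Lemma proj_ualg z : proj (ualg_incl z) = counit z *: 1.
Proof.
move: z; apply: galg_ext => [||u].
- exact: linear_comp proj_linear (gext_linear ulike).
- exact: scalar_linear counit_linear.
rewrite gelt_counit scale1r -proj1.
transitivity (proj_fun (ulike u)); first exact: congr1 (galg_homE _ _ u).
by rewrite /ulike -[val u]mulg1 proj_U //; exact: subgroup_valP.
Qed.

(** A linear section of the projection, given by a choice of representatives. *)
Definition lift_quo : galg k PU -> A :=
  gext (fun q : PU => gelt (repr q).1 ⊗ gelt (repr q).2).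

Lemma lift_quo_linear : linear lift_quo.
Proof. exact: gext_linear. Qed.

Lemma lift_quoK : cancel lift_quo proj.
Proof.
apply: galg_ext => [||q]; last 1 first.
- rewrite /lift_quo gext1 -[LHS]/(proj_fun _) proj_funE -surjective_pairing.
  by rewrite coset_reprK.
- exact: linear_comp proj_linear (gext_linear _).
- exact: linear_id.
Qed.

(** An element of the kernel is the difference between itself and the lift of
    its image.  That difference is in [k[U]^+ A] for every element, because two
    elements [a ⊗ g] and [a ⊗ h] with the same image satisfy
    [a ⊗ g - a ⊗ h = (1 ⊗ u - 1) (a ⊗ h)] for [u = h^-1 g] in [U].  Conversely,
    the projection acts on [k[U]] by the counit. *)
Lemma proj_kernel x : proj x = 0 <-> aug_ideal ualg [set: A] x.
Proof.
split=> [x0|[s sP ->]].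
  suff aug y : aug_ideal ualg [set: A] (y - lift_quo (proj y)).
    by have := aug x; rewrite x0 (lin0 lift_quo_linear) subr0.
  move: y; apply: biproduct_span => [|c x' y ax ay|a g].
  - rewrite rmorph0 (lin0 lift_quo_linear) subr0.
    by exists [::]; rewrite ?big_nil.
  - rewrite linearP lift_quo_linear opprD addrACA -scalerBr.
    exact: aug_ideal_linear.
  rewrite -[proj _]/(proj_fun _) proj_funE /lift_quo gext1.
  have := coset_reprK [(a, g) : P].
  case: (repr _) => b h /coset_classP/= [/= e Uu].
  have {e} <- : b = a.
    apply/(mulgI b^-1%g)/(can_inj (autK (pi h^-1%g))).
    by rewrite mulVg autM e aut1.
  pose u := subgroup_elt (bd_subgroup D) Uu.
  exists [:: (ulike u - 1, gelt b ⊗ gelt h)].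
    move=> _ /[!inE] /eqP -> /=; split=> //.
      exists (gelt u - 1) => //.
      by rewrite rmorphB rmorph1; congr (_ - _); exact: galg_homE.
    rewrite addrC -scaleN1r (@counit_linear k A) counit1 ulike_counit.
    by rewrite mulr1 addNr.
  have [pu cu] := bd_ker Uu.
  rewrite big_seq1 /= mulrBl mul1r biproductM mul1r pu gmap_id cu.
  by rewrite mulgA mulgV mul1g.
rewrite rmorph_sum big_seq big1 // => u /sP[[z _ uz] cu _].
rewrite rmorphM [X in X * _](_ : _ = 0) ?mul0r //.
rewrite -uz in cu *; have [_ ue _] := ualg_incl_hopf; rewrite ue in cu.
by rewrite [LHS]proj_ualg cu scale0r.
Qed.

(** * The lower normal series *)

Lemma scalars_central (a x : A) :
  range (fun c : k => c *: (1 : A)) x -> a * x = x * a.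
Proof. by move=> [c _ <-]; rewrite -scalerAr -scalerAl mulr1 mul1r. Qed.

Lemma lower_cosolvable_biproduct : lower_cosolvable A.
Proof.
(* The scalars, as the default value of the list, are the last term F 2. *)
pose F n : set A :=
  nth (range (fun c : k => c *: (1 : A))) [:: [set: A]; ualg] n.
exists 2%N, F; split; first split=> //.
- case=> [|[|[|//]]] _ /=.
  + by have := hopf_morphism_range (hopf_morphism_id A); rewrite image_id.
  + exact: ualg_subalgebra.
  + exact: scalars_subalgebra.
- have [UL [U1 _] _ _] := ualg_subalgebra.
  have U0 : ualg 0 by exists 0 => //; exact: rmorph0.
  have UZ c x : ualg x -> ualg (c *: x).
    by move=> Ux; rewrite -[_ *: _]addr0; apply: UL.
  case=> [|[|//]] _ /=; split=> //.
  + apply: central_normal UZ => a x; exact: ualg_central.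
  + by move=> _ [c _ <-]; exact: UZ U1.
  + apply: central_normal => [a x|c _ [d _ <-]]; first exact: scalars_central.
    by exists (c * d); rewrite ?scalerA.
case=> [|[|//]] _.
- exists (galg k PU); split; last exact: galg_cocommutative.
  exists A, idfun, proj; split=> //.
  + exact: hopf_morphism_id.
  + by rewrite image_id.
  + exact: proj_hopf.
  split; last exact: proj_kernel.
  by apply/seteqP; split=> // q _; exists (lift_quo q); rewrite ?lift_quoK.
exists (galg k UT); split; last exact: galg_cocommutative.
exists (galg k UT), ualg_incl, idfun; split=> //.
- exact: ualg_incl_hopf.
- exact: ualg_incl_inj.
- exact: hopf_morphism_id.
split; first by rewrite image_id.
move=> z /=; split=> [->|/aug_ideal_scalars uz].
  by exists [::]; rewrite ?big_nil ?rmorph0.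
by apply: ualg_incl_inj; rewrite [RHS]rmorph0; exact: uz.
Qed.

End BiproductSeries.

Theorem theorem5 (k : fieldType) (G GG : groupType)
    (pi : {multiplicative G -> groupAut GG}) (theta : groupAut GG)
    (boldU : set G) (bold : k -> G)
    (orbit_fin : forall a : GG, finite_set (group_orbit theta a))
    (theta_diag : lin_diagonalizable (gmap (k := k) theta))
    (pi_theta : forall g : G, (pi g * theta = theta * pi g)%g)
    (boldU_group : is_subgroup boldU)
    (bold_morph : forall x y : k,
        eigen_group (gmap (k := k) theta) x ->
        eigen_group (gmap (k := k) theta) y ->
        bold (x * y) = (bold x * bold y)%g)
    (bold_bij : set_bij (eigen_group (gmap (k := k) theta)) boldU bold)
    (boldU_sub : boldU `<=` [set g : G | pi g = 1%g] `&` group_center G) :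
  lower_cosolvable (biproduct
    (BiproductDatum theta_diag pi_theta boldU_group bold_morph bold_bij
       boldU_sub)).
Proof. exact: lower_cosolvable_biproduct. Qed.
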